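(* Let $p$ be a prime and let $k$ be a field of characteristic $p$. Let $$\Lambda_1=k\langle y,z\rangle/\langle y^p,\,yz-zy,\,z^p\rangle\quad\text{and}\quad \Lambda_2=k\langle y,z\rangle/\langle y^p,\,yz-zy-y^2,\,z^p\rangle,$$ viewed as quotients of the path algebra of the quiver with one vertex and two loops $y,z$. Let $G=\langle\sigma\rangle=C_p$ be the cyclic group of order $p$, with identity $e$. (a) The underlying algebras of types B1 and C11 are isomorphic (both are $k\langle x,y,z\rangle/\langle [x,y]-y,[x,z],[y,z],x^p-x,y^p,z^p\rangle$), and they are isomorphic to the covering of the local algebra $\Lambda_1$ with the weight function $w\colon\{y,z\}\to G$ given by $w(y)=\sigma$ and $w(z)=e$. (b) For $p>2$, the algebra B3 $=k\langle x,y,z\rangle/\langle [x,y]-y,[x,z]-z,[y,z]-y^2,x^p-x,y^p,z^p\rangle$ is isomorphic to the covering of the local algebra $\Lambda_2$ with the weight function $w(y)=w(z)=\sigma$. (c) Assume that $k$ contains the field of order $p^2$ if $p>2$. Let $\lambda\in k^\times$ be such that $\delta=\lambda^{p-1}=\pm1$. Then the algebra (of type C16) $C(\lambda,\delta)=k\langle x,y,z\rangle/\langle [x,y],[x,z]-\lambda x,[y,z]-\lambda^{-1}y,x^p,y^p,z^p-\delta z\rangle$ is isomorphic to the covering of the local algebra $\Lambda_1$ with a weight function $w$ of the form $w(y)=\sigma^{-1}$ and $w(z)=\sigma^{-a}$ for some integer $a$; precisely, $a$ is such that $\lambda^{-1}=a\lambda$ in $k$.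
   Context: $[a,b]=ab-ba$. Coverings: let $\Lambda=kQ/I$ be an admissible quotient of a path algebra $kQ$, where $Q_0,Q_1$ are the vertices and arrows of $Q$, and $\mathfrak{o}(a),\mathfrak{t}(a)$ denote the origin and terminus of an arrow $a$. Paths are written from right to left, so $a_n\cdots a_1$ means first $a_1$, then $a_2$, etc. Let $G$ be a finite group and $w\colon Q_1\to G$ any function (a weight function). The weight of a path $a_n\cdots a_2a_1$ is $w(a_1)w(a_2)\cdots w(a_n)$, and trivial paths have weight $e$. Assume $I$ is generated by weight homogeneous elements. The covering quiver $\widetilde Q(w)$ has vertices $(v,g)$ for $v\in Q_0$, $g\in G$, and arrows $(a,g)\colon(\mathfrak{o}(a),g)\to(\mathfrak{t}(a),g\,w(a))$ for $a\in Q_1$, $g\in G$. Each path $q$ in $Q$ and $g\in G$ has a unique lifting to a path in $\widetilde Q(w)$ starting in $(\mathfrak{o}(q),g)$ that maps to $q$ under $(v,g)\mapsto v$, $(a,g)\mapsto a$; this extends linearly to weight homogeneous elements. $\widetilde I(w)$ is the ideal of $k\widetilde Q(w)$ generated by all liftings (for all $g\in G$) of a set of weight homogeneous generators of $I$ (uniform relations). The covering of $\Lambda$ with weight function $w$ is the algebra $k\widetilde Q(w)/\widetilde I(w)$. *)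

(* Defs.v *)
From HB Require Import structures.
From mathcomp Require Import all_boot all_order all_fingroup all_algebra.
From mathcomp Require Import boolp classical_sets.
From mathcomp Require Import finmap monalg.

Set Implicit Arguments.
Unset Strict Implicit.
Unset Printing Implicit Defensive.

Import GRing.Theory.

Local Open Scope ring_scope.

Section AlgebraQuotient.
Variables (k : fieldType) (A : algType k).

Inductive ideal_gen (S : set A) : set A :=
| ideal_gen_in x of S x : ideal_gen S x
| ideal_gen0 : ideal_gen S 0
| ideal_genD x y of ideal_gen S x & ideal_gen S y : ideal_gen S (x + y)
| ideal_genMl a x of ideal_gen S x : ideal_gen S (a * x)
| ideal_genMr a x of ideal_gen S x : ideal_gen S (x * a).

Definition ideal_pred (S : set A) : {pred A} := fun x => `[< ideal_gen S x >].

Lemma ideal_predP (S : set A) x : reflect (ideal_gen S x) (x \in ideal_pred S).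
Proof. exact: asboolP. Qed.

Lemma ideal_pred_zmod_closed (S : set A) : zmod_closed (ideal_pred S).
Proof.
split=> [|x y /ideal_predP Sx /ideal_predP Sy]; apply/ideal_predP.
  exact: ideal_gen0.
by apply: ideal_genD => //; rewrite -mulN1r; apply: ideal_genMl.
Qed.

HB.instance Definition _ (S : set A) :=
  GRing.isZmodClosed.Build A (ideal_pred S) (ideal_pred_zmod_closed S).

Variable S : set A.

Definition alg_quot : Type := {ideal_quot (ideal_pred S)}.

HB.instance Definition _ := GRing.Zmodule.on alg_quot.

Definition alg_pi : A -> alg_quot := \pi_({ideal_quot (ideal_pred S)})%qT.
Let rep (x : alg_quot) : A := generic_quotient.repr x.

Lemma alg_piP x y : reflect (ideal_gen S (x - y)) (alg_pi x == alg_pi y).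
Proof.
by rewrite /alg_pi -(Quotient.idealrBE (ideal_pred S)); apply: ideal_predP.
Qed.

Lemma alg_piK x : alg_pi (rep x) = x. Proof. exact: generic_quotient.reprK. Qed.

Lemma alg_pi_ind (P : alg_quot -> Prop) :
  (forall x, P (alg_pi x)) -> forall x, P x.
Proof. by move=> Ppi x; rewrite -(alg_piK x). Qed.

Lemma alg_piD x y : alg_pi (x + y) = alg_pi x + alg_pi y.
Proof. exact: ((@Quotient.pi_add A (ideal_pred S))). Qed.

Let rep_pi x : ideal_gen S (rep (alg_pi x) - x).
Proof. by apply/alg_piP; rewrite alg_piK. Qed.

Definition alg_quot_mul (x y : alg_quot) : alg_quot := alg_pi (rep x * rep y).
Definition alg_quot_scale (a : k) (x : alg_quot) : alg_quot :=
  alg_pi (a *: rep x).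

Lemma alg_pi_mul x y : alg_quot_mul (alg_pi x) (alg_pi y) = alg_pi (x * y).
Proof.
apply/eqP/alg_piP; set x' := rep _; set y' := rep _.
have -> : x' * y' - x * y = (x' - x) * y' + x * (y' - y).
  by rewrite mulrBl mulrBr addrA subrK.
by apply: ideal_genD; [apply: ideal_genMr | apply: ideal_genMl]; apply: rep_pi.
Qed.

Lemma alg_pi_scale a x : alg_quot_scale a (alg_pi x) = alg_pi (a *: x).
Proof.
apply/eqP/alg_piP; rewrite -scalerBr -[_ - _]mul1r scalerAl.
by apply: ideal_genMl; apply: rep_pi.
Qed.

Lemma alg_quot_mulA : associative alg_quot_mul.
Proof.
elim/alg_pi_ind=> x; elim/alg_pi_ind=> y; elim/alg_pi_ind=> z.
by rewrite !alg_pi_mul mulrA.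
Qed.

Lemma alg_quot_mul1 : left_id (alg_pi 1) alg_quot_mul.
Proof. by elim/alg_pi_ind=> x; rewrite alg_pi_mul mul1r. Qed.

Lemma alg_quot_mulr1 : right_id (alg_pi 1) alg_quot_mul.
Proof. by elim/alg_pi_ind=> x; rewrite alg_pi_mul mulr1. Qed.

Lemma alg_quot_mulDl : left_distributive alg_quot_mul +%R.
Proof.
elim/alg_pi_ind=> x; elim/alg_pi_ind=> y; elim/alg_pi_ind=> z.
by rewrite -alg_piD !alg_pi_mul -alg_piD mulrDl.
Qed.

Lemma alg_quot_mulDr : right_distributive alg_quot_mul +%R.
Proof.
elim/alg_pi_ind=> x; elim/alg_pi_ind=> y; elim/alg_pi_ind=> z.
by rewrite -alg_piD !alg_pi_mul -alg_piD mulrDr.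
Qed.

HB.instance Definition _ := GRing.Zmodule_isPzRing.Build alg_quot
  alg_quot_mulA alg_quot_mul1 alg_quot_mulr1 alg_quot_mulDl alg_quot_mulDr.

Lemma alg_quot_scaleA a b x :
  alg_quot_scale a (alg_quot_scale b x) = alg_quot_scale (a * b) x.
Proof. by elim/alg_pi_ind: x => x; rewrite !alg_pi_scale scalerA. Qed.

Lemma alg_quot_scale1 : left_id 1 alg_quot_scale.
Proof. by elim/alg_pi_ind=> x; rewrite alg_pi_scale scale1r. Qed.

Lemma alg_quot_scaleDr : right_distributive alg_quot_scale +%R.
Proof.
move=> a; elim/alg_pi_ind=> x; elim/alg_pi_ind=> y.
by rewrite -alg_piD !alg_pi_scale -alg_piD scalerDr.
Qed.

Lemma alg_quot_scaleDl x : {morph alg_quot_scale^~ x : a b / a + b}.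
Proof.
by elim/alg_pi_ind: x => x a b; rewrite !alg_pi_scale -alg_piD scalerDl.
Qed.

HB.instance Definition _ := GRing.Zmodule_isLmodule.Build k alg_quot
  alg_quot_scaleA alg_quot_scale1 alg_quot_scaleDr alg_quot_scaleDl.

Lemma alg_quot_scaleAl (a : k) (u v : alg_quot) : a *: (u * v) = (a *: u) * v.
Proof.
elim/alg_pi_ind: u => u; elim/alg_pi_ind: v => v.
rewrite /GRing.scale /GRing.mul /=.
by rewrite !(alg_pi_mul, alg_pi_scale) scalerAl.
Qed.

Lemma alg_quot_scaleAr (a : k) (u v : alg_quot) : a *: (u * v) = u * (a *: v).
Proof.
elim/alg_pi_ind: u => u; elim/alg_pi_ind: v => v.
rewrite /GRing.scale /GRing.mul /=.
by rewrite !(alg_pi_mul, alg_pi_scale) scalerAr.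
Qed.

End AlgebraQuotient.

Definition quot_alg_iso (k : fieldType) (A B : algType k)
    (S : set A) (T : set B) : Prop :=
  exists2 f : {rmorphism alg_quot S -> alg_quot T}, scalable f & bijective f.

Lemma malg_scaleU (k : fieldType) (K : choiceType) (a c : k) (m : K) :
  a *: << c *g m >> = << a * c *g m >> :> {malg k[K]}.
Proof.
by apply/malgP=> l; rewrite mcoeffZ [in LHS]mcoeffU [RHS]mcoeffU mulrnAr.
Qed.

Lemma fgmul_scaleAr (k : fieldType) (K : monomType) (a : k)
    (g1 g2 : {malg k[K]}) :
  a *: (g1 * g2) = g1 * (a *: g2).
Proof.
rewrite !malgM_def (fgmullw (fsubset_refl _) (msuppZ_le a g2)) scaler_sumr.
apply: eq_bigr => i _; rewrite scaler_sumr; apply: eq_bigr => j _.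
by rewrite malg_scaleU mcoeffZ mulrCA.
Qed.

Definition free_alg (k : fieldType) (n : nat) : Type := {malg k[{fmonom 'I_n}]}.

Section FreeAlgebra.
Variables (k : fieldType) (n : nat).

HB.instance Definition _ := GRing.Lalgebra.on (free_alg k n).
HB.instance Definition _ :=
  GRing.Lalgebra_isAlgebra.Build k (free_alg k n) (@fgmul_scaleAr k _).

Definition free_gen (i : 'I_n) : free_alg k n := << fmu i >>.

End FreeAlgebra.

(* Vertices are required to exist so that kQ is nonzero, hence an algType. *)
Record quiver := Quiver {
  vert : finType;
  arr : finType;
  org : arr -> vert;
  ter : arr -> vert;
  vert_gt0 : (0 < #|vert|)%N
}.

Section Paths.
Variable Q : quiver.

Fixpoint walk (v : vert Q) (s : seq (arr Q)) : bool :=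
  if s is a :: s' then (org a == v) && walk (ter a) s' else true.

Definition walk_end (v : vert Q) (s : seq (arr Q)) : vert Q :=
  last v [seq ter a | a <- s].

(* A path is its origin together with its arrows in order of traversal: the
   path written a_n...a_1 has arrow sequence [:: a_1; ...; a_n]. *)
Record qpath := QPath {
  qpath_val : vert Q * seq (arr Q);
  _ : walk qpath_val.1 qpath_val.2
}.

HB.instance Definition _ := [isSub for qpath_val].
HB.instance Definition _ := [Choice of qpath by <:].

Definition porg (q : qpath) : vert Q := (qpath_val q).1.
Definition parrs (q : qpath) : seq (arr Q) := (qpath_val q).2.
Definition pter (q : qpath) : vert Q := walk_end (porg q) (parrs q).
Definition plen (q : qpath) : nat := size (parrs q).

Definition trivial_path (v : vert Q) : qpath :=
  @QPath (v, [::]) isT.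

Lemma arr_walk (a : arr Q) : walk (org a) [:: a].
Proof. by rewrite /= eqxx. Qed.

Definition arr_path (a : arr Q) : qpath :=
  @QPath (org a, [:: a]) (arr_walk a).

Lemma walk_cat v s t : walk v (s ++ t) = walk v s && walk (walk_end v s) t.
Proof. by elim: s v => //= a s IHs v; rewrite IHs andbA. Qed.

Lemma walk_end_cat v s t : walk_end v (s ++ t) = walk_end (walk_end v s) t.
Proof. by rewrite /walk_end map_cat last_cat. Qed.

(* qpath_comp q r is the path written qr: first r, then q. *)
Definition qpath_comp (q r : qpath) : option qpath :=
  if pter r == porg q then insub (porg r, parrs r ++ parrs q) else None.

Lemma qpathP (q : qpath) : walk (porg q) (parrs q).
Proof. by case: q. Qed.

Lemma qpath_inj (q r : qpath) : porg q = porg r -> parrs q = parrs r -> q = r.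
Proof.
case: q r => [[v s] Hq] [[w t] Hr]; rewrite /porg /parrs /= => e1 e2.
by apply: val_inj; rewrite /= e1 e2.
Qed.

Variant qpath_comp_spec (q r : qpath) : option qpath -> Prop :=
| QpathCompSome s of pter r = porg q & porg s = porg r
    & parrs s = parrs r ++ parrs q & pter s = pter q :
    qpath_comp_spec q r (Some s)
| QpathCompNone of pter r <> porg q : qpath_comp_spec q r None.

Lemma pcompP q r : qpath_comp_spec q r (qpath_comp q r).
Proof.
rewrite /qpath_comp; case: eqP => [e|]; last by constructor.
case: insubP => [s _ Es|]; last first.
  by rewrite /= walk_cat qpathP -/(pter r) e qpathP.
have Eo : porg s = porg r by rewrite /porg [qpath_val s]Es.
have Ea : parrs s = parrs r ++ parrs q by rewrite /parrs [qpath_val s]Es.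
by constructor=> //; rewrite /pter Ea Eo walk_end_cat -/(pter r) e.
Qed.

Lemma pcompA q r s :
  obind (qpath_comp q) (qpath_comp r s) =
  obind (fun t => qpath_comp t s) (qpath_comp q r).
Proof.
case: (pcompP r s) => [rs e1 o1 a1 t1|ne1] /=;
  case: (pcompP q r) => [qr e2 o2 a2 t2|ne2] //=.
- case: pcompP => [u _ o3 a3 _|]; last by rewrite t1.
  case: pcompP => [w _ o4 a4 _|]; last by rewrite o2.
  by congr Some; apply: qpath_inj; rewrite ?o3 ?o4 ?a3 ?a4 ?a1 ?a2 ?catA ?o1.
- by case: pcompP => // u; rewrite t1.
- by case: pcompP => // u; rewrite o2.
Qed.

Lemma pcomp1q v q :
  qpath_comp (trivial_path v) q = if pter q == v then Some q else None.
Proof.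
case: pcompP => [s /= e o a _|/=]; last by case: eqP.
by rewrite e eqxx; congr Some; apply: qpath_inj => //; rewrite a cats0.
Qed.

Lemma pcompq1 v q :
  qpath_comp q (trivial_path v) = if v == porg q then Some q else None.
Proof.
case: pcompP => [s /= e o a _|/=]; last by case: eqP.
by rewrite -e eqxx; congr Some; apply: qpath_inj; rewrite ?o -?e.
Qed.

End Paths.

Definition path_alg (k : fieldType) (Q : quiver) : Type := {malg k[qpath Q]}.

Definition omono (k : fieldType) (Q : quiver) (c : k) (o : option (qpath Q)) :
    {malg k[qpath Q]} :=
  if o is Some s then << c *g s >> else 0.

HB.lock Definition path_mul (k : fieldType) (Q : quiver)
    (g1 g2 : {malg k[qpath Q]}) : {malg k[qpath Q]} :=
  \sum_(q <- msupp g1) \sum_(r <- msupp g2)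
     omono (g1@_q * g2@_r) (qpath_comp q r).

Section PathAlgebra.
Variables (k : fieldType) (Q : quiver).
Local Notation kQ := {malg k[qpath Q]}.
Implicit Types (g : kQ) (q : qpath Q) (c : k).
Local Notation path_mul := (@path_mul k Q).

Definition path_one : kQ := \sum_(v : vert Q) << trivial_path v >>.

Lemma path_mulE g1 g2 :
  path_mul g1 g2 =
    \sum_(q <- msupp g1) \sum_(r <- msupp g2)
     omono (g1@_q * g2@_r) (qpath_comp q r).
Proof. by rewrite path_mul.unlock. Qed.

Lemma omono0 (o : option (qpath Q)) : omono 0 o = 0 :> kQ.
Proof. by case: o => [s|//]; exact: monalgU0. Qed.

Lemma omonoD c1 c2 (o : option (qpath Q)) :
  omono (c1 + c2) o = omono c1 o + omono c2 o.
Proof. by case: o => [s|] /=; [exact: monalgUD | rewrite addr0]. Qed.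

Lemma path_mulw (d1 d2 : {fset qpath Q}) g1 g2 :
  (msupp g1 `<=` d1)%fset -> (msupp g2 `<=` d2)%fset ->
  path_mul g1 g2 =
    \sum_(q <- d1) \sum_(r <- d2) omono (g1@_q * g2@_r) (qpath_comp q r).
Proof.
move=> le_d1 le_d2; rewrite path_mulE (big_fset_incl _ le_d1) /=.
  apply/eq_bigr=> q _; apply/big_fset_incl => // r _ /mcoeff_outdom ->.
  by rewrite mulr0 omono0.
move=> q _ /mcoeff_outdom g1q.
by rewrite big1 => // r _; rewrite g1q mul0r omono0.
Qed.

Lemma path_mulDl : left_distributive path_mul +%R.
Proof.
move=> g1 g2 g.
rewrite (path_mulw (msuppD_le _ _) (fsubset_refl _)).
rewrite (path_mulw (fsubsetUl _ (msupp g2)) (fsubset_refl _)).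
rewrite (path_mulw (fsubsetUr (msupp g1) _) (fsubset_refl _)).
rewrite -big_split /=; apply/eq_bigr=> q _.
rewrite -big_split /=; apply/eq_bigr=> r _.
by rewrite mcoeffD mulrDl; apply: omonoD.
Qed.

Lemma path_mulDr : right_distributive path_mul +%R.
Proof.
move=> g g1 g2.
rewrite (path_mulw (fsubset_refl _) (msuppD_le _ _)).
rewrite (path_mulw (fsubset_refl _) (fsubsetUl _ (msupp g2))).
rewrite (path_mulw (fsubset_refl _) (fsubsetUr (msupp g1) _)).
rewrite -big_split /=; apply/eq_bigr=> q _.
rewrite -big_split /=; apply/eq_bigr=> r _.
by rewrite mcoeffD mulrDr; apply: omonoD.
Qed.

Lemma path_mul0g : left_zero 0 path_mul.
Proof. by move=> g; rewrite path_mulE msupp0 big_seq_fset0. Qed.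

Lemma path_mulg0 : right_zero 0 path_mul.
Proof.
by move=> g; rewrite path_mulE big1 // => q _; rewrite msupp0 big_seq_fset0.
Qed.

Lemma path_mulUU c1 c2 q r :
  path_mul << c1 *g q >> << c2 *g r >> = omono (c1 * c2) (qpath_comp q r).
Proof. by rewrite (path_mulw msuppU_le msuppU_le) !big_seq_fset1 !mcoeffUU. Qed.

Lemma path_mul_suml I (r : seq I) (P : pred I) F g :
  path_mul (\sum_(i <- r | P i) F i) g = \sum_(i <- r | P i) path_mul (F i) g.
Proof.
by rewrite (big_morph (path_mul^~ g)
  (fun _ _ => path_mulDl _ _ _) (path_mul0g _)).
Qed.

Lemma path_mul_sumr I (r : seq I) (P : pred I) F g :
  path_mul g (\sum_(i <- r | P i) F i) = \sum_(i <- r | P i) path_mul g (F i).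
Proof.
by rewrite (big_morph (path_mul g)
  (fun _ _ => path_mulDr _ _ _) (path_mulg0 _)).
Qed.

Lemma path_mulEl g1 g2 :
  path_mul g1 g2 = \sum_(q <- msupp g1) path_mul << g1@_q *g q >> g2.
Proof. by rewrite {1}[g1]monalgE path_mul_suml. Qed.

Lemma path_mulEr g1 g2 :
  path_mul g1 g2 = \sum_(r <- msupp g2) path_mul g1 << g2@_r *g r >>.
Proof. by rewrite {1}[g2]monalgE path_mul_sumr. Qed.

Lemma path_mulUA c1 c2 c3 q r s :
  path_mul << c1 *g q >> (path_mul << c2 *g r >> << c3 *g s >>) =
  path_mul (path_mul << c1 *g q >> << c2 *g r >>) << c3 *g s >>.
Proof.
have E1 := path_mulUU c2 c3 r s; have E2 := path_mulUU c1 c2 q r.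
apply: (etrans (congr1 (path_mul _) E1)).
apply: (etrans _ (congr1 (path_mul^~ _) (esym E2))).
have := pcompA q r s.
case: (qpath_comp r s) => [rs|]; case: (qpath_comp q r) => [qr|] /= E.
- have E3 := path_mulUU c1 (c2 * c3) q rs.
  have E4 := path_mulUU (c1 * c2) c3 qr s.
  by apply: (etrans E3); rewrite mulrA E; apply: esym E4.
- have E3 := path_mulUU c1 (c2 * c3) q rs.
  by apply: (etrans E3); rewrite E path_mul0g.
- have E4 := path_mulUU (c1 * c2) c3 qr s.
  by apply: (etrans _ (esym E4)); rewrite -E path_mulg0.
- by rewrite path_mulg0 path_mul0g.
Qed.

Lemma path_mulA : associative path_mul.
Proof.
move=> g1 g2 g3.
rewrite (path_mulEl g1 (path_mul g2 g3)) (path_mulEl g1 g2) path_mul_suml.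
apply/eq_bigr=> q _.
have := fun c2 c3 => path_mulUA (g1@_q) c2 c3 q.
move: (<< _ *g q >>) => x /= UA.
rewrite (path_mulEl g2 g3) path_mul_sumr (path_mulEr x g2) path_mul_suml.
apply/eq_bigr=> r _; have := fun c3 => UA (g2@_r) c3 r.
move: (<< _ *g r >>) => y /= {}UA.
rewrite (path_mulEr y g3) path_mul_sumr (path_mulEr (path_mul x y) g3).
by apply/eq_bigr=> s _; apply: (UA (g3@_s) s).
Qed.

Lemma path_mul1U c q : path_mul path_one << c *g q >> = << c *g q >>.
Proof.
rewrite /path_one path_mul_suml (bigD1 (pter q)) //=.
rewrite path_mulUU pcomp1q eqxx mul1r /= big1 ?addr0 // => v ne_v.
by rewrite path_mulUU pcomp1q eq_sym (negbTE ne_v).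
Qed.

Lemma path_mulU1 c q : path_mul << c *g q >> path_one = << c *g q >>.
Proof.
rewrite /path_one path_mul_sumr (bigD1 (porg q)) //=.
rewrite path_mulUU pcompq1 eqxx mulr1 /= big1 ?addr0 // => v ne_v.
by rewrite path_mulUU pcompq1 (negbTE ne_v).
Qed.

Lemma path_mul1g : left_id path_one path_mul.
Proof.
move=> g; rewrite [LHS]path_mulEr [RHS]monalgE.
by apply/eq_bigr=> q _; apply: path_mul1U.
Qed.

Lemma path_mulg1 : right_id path_one path_mul.
Proof.
move=> g; rewrite [LHS]path_mulEl [RHS]monalgE.
by apply/eq_bigr=> q _; apply: path_mulU1.
Qed.

Lemma path_one_neq0 : path_one != 0.
Proof.
have /card_gt0P[v _] := vert_gt0 Q.
apply/eqP=> /(congr1 (mcoeff (trivial_path v))) /eqP.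
rewrite raddf_sum (bigD1 v) //= mcoeffUU mcoeff0.
rewrite big1 ?addr0 ?oner_eq0 // => w ne_w.
rewrite mcoeffU; case: eqP => // e; case/eqP: ne_w.
exact: (congr1 (@porg Q) e).
Qed.

HB.instance Definition _ := GRing.Lmodule.on (path_alg k Q).
HB.instance Definition _ := GRing.Zmodule_isNzRing.Build (path_alg k Q)
  path_mulA path_mul1g path_mulg1 path_mulDl path_mulDr path_one_neq0.

Lemma path_scale_omono (a c : k) (o : option (qpath Q)) :
  a *: omono c o = omono (a * c) o.
Proof. by case: o => [s|] /=; [exact: malg_scaleU | exact: scaler0]. Qed.

Lemma path_mulZl (a : k) g1 g2 : a *: path_mul g1 g2 = path_mul (a *: g1) g2.
Proof.
rewrite [RHS](path_mulw (msuppZ_le a g1) (fsubset_refl _)) path_mulE.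
rewrite scaler_sumr.
apply/eq_bigr=> q _; rewrite scaler_sumr; apply/eq_bigr=> r _.
by rewrite path_scale_omono mcoeffZ mulrA.
Qed.

Lemma path_mulZr (a : k) g1 g2 : a *: path_mul g1 g2 = path_mul g1 (a *: g2).
Proof.
rewrite [RHS](path_mulw (fsubset_refl _) (msuppZ_le a g2)) path_mulE.
rewrite scaler_sumr.
apply/eq_bigr=> q _; rewrite scaler_sumr; apply/eq_bigr=> r _.
by rewrite path_scale_omono mcoeffZ mulrCA.
Qed.

HB.instance Definition _ :=
  GRing.Lmodule_isLalgebra.Build k (path_alg k Q) path_mulZl.
HB.instance Definition _ :=
  GRing.Lalgebra_isAlgebra.Build k (path_alg k Q) path_mulZr.

Definition arr_elt (a : arr Q) : path_alg k Q := << arr_path a >>.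

End PathAlgebra.

(* kQ/I is presented by a set of generators of I. *)
Record bound_quiver (k : fieldType) := BoundQuiver {
  bq_quiver : quiver;
  bq_rels : set (path_alg k bq_quiver)
}.
Arguments bq_rels {k} P _ : rename.

(* J^N <= I <= J^2 for the arrow ideal J; J^n is spanned by the paths of length
   at least n. *)
Definition admissible (k : fieldType) (P : bound_quiver k) : Prop :=
  (exists N : nat, forall q : qpath (bq_quiver P),
     (N <= plen q)%N -> ideal_gen (bq_rels P) << q >>) /\
  (forall r : path_alg k (bq_quiver P), ideal_gen (bq_rels P) r ->
     forall q, q \in msupp r -> (2 <= plen q)%N).

Section Covering.
Variables (k : fieldType) (Q : quiver) (gT : finGroupType) (w : arr Q -> gT).

Definition weight (q : qpath Q) : gT := (\prod_(a <- parrs q) w a)%g.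

Definition uniform (r : path_alg k Q) : Prop :=
  exists u v : vert Q, forall q, q \in msupp r -> porg q = u /\ pter q = v.

Definition weight_homogeneous (r : path_alg k Q) : Prop :=
  exists g : gT, forall q, q \in msupp r -> weight q = g.

Lemma covering_vert_gt0 : (0 < #|{: vert Q * gT}|)%N.
Proof. by rewrite card_prod muln_gt0 vert_gt0 -cardsT cardG_gt0. Qed.

Definition covering_quiver : quiver :=
  @Quiver (vert Q * gT)%type (arr Q * gT)%type
    (fun b => (org b.1, b.2)) (fun b => (ter b.1, (b.2 * w b.1)%g))
    covering_vert_gt0.

Fixpoint lift_walk (g : gT) (s : seq (arr Q)) : seq (arr Q * gT) :=
  if s is a :: s' then (a, g) :: lift_walk (g * w a)%g s' else [::].

Lemma lift_walkP (v : vert Q) g s :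
  walk v s -> @walk covering_quiver (v, g) (lift_walk g s).
Proof.
elim: s v g => //= a s IHs v g /andP[/eqP-> /IHs->]; by rewrite eqxx.
Qed.

Definition lift_path (g : gT) (q : qpath Q) : qpath covering_quiver :=
  @QPath covering_quiver (porg q, g, lift_walk g (parrs q))
    (lift_walkP g (qpathP q)).

Definition lift_elt (g : gT) (r : path_alg k Q) : path_alg k covering_quiver :=
  \sum_(q <- msupp r) << r@_q *g lift_path g q >>.

End Covering.

Definition covering (k : fieldType) (P : bound_quiver k) (gT : finGroupType)
    (w : arr (bq_quiver P) -> gT) : bound_quiver k :=
  @BoundQuiver k (covering_quiver w)
    [set x | exists2 r, bq_rels P r & exists g, x = lift_elt w g r].

(* The standing assumptions under which the covering is defined. *)
Definition coverable (k : fieldType) (P : bound_quiver k) (gT : finGroupType)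
    (w : arr (bq_quiver P) -> gT) : Prop :=
  admissible P /\
  forall r, bq_rels P r -> uniform r /\ weight_homogeneous w r.

Definition iso_covering (k : fieldType) (A : algType k) (R : set A)
    (P : bound_quiver k) (gT : finGroupType) (w : arr (bq_quiver P) -> gT)
    : Prop :=
  coverable w /\ quot_alg_iso R (bq_rels (covering w)).
Arguments iso_covering {k A} R P {gT} w.

Lemma loop_vert_gt0 : (0 < #|{: unit}|)%N. Proof. by rewrite card_unit. Qed.

Definition two_loops : quiver :=
  @Quiver unit 'I_2 (fun=> tt) (fun=> tt) loop_vert_gt0.

Definition loop_y : arr two_loops := ord0.
Definition loop_z : arr two_loops := ord_max.

Definition loop_weight (gT : finGroupType) (wy wz : gT) (a : arr two_loops) :
    gT :=
  if a == loop_y then wy else wz.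

Definition bracket (R : pzRingType) (a b : R) : R := a * b - b * a.

Section Presentations.
Variables (k : fieldType) (p : nat).

Definition Lambda1 : bound_quiver k :=
  let y := arr_elt k loop_y in let z := arr_elt k loop_z in
  @BoundQuiver k two_loops [set y ^+ p; y * z - z * y; z ^+ p].

Definition Lambda2 : bound_quiver k :=
  let y := arr_elt k loop_y in let z := arr_elt k loop_z in
  @BoundQuiver k two_loops [set y ^+ p; y * z - z * y - y ^+ 2; z ^+ p].

Definition gen_x : free_alg k 3 := free_gen k (@Ordinal 3 0 isT).
Definition gen_y : free_alg k 3 := free_gen k (@Ordinal 3 1 isT).
Definition gen_z : free_alg k 3 := free_gen k (@Ordinal 3 2 isT).
Local Notation x := gen_x.
Local Notation y := gen_y.
Local Notation z := gen_z.

Definition B1_rels : set (free_alg k 3) :=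
  [set bracket x y - y; bracket x z; bracket y z; x ^+ p - x; y ^+ p; z ^+ p].

Definition C11_rels : set (free_alg k 3) :=
  [set bracket x y - y; bracket x z; bracket y z; x ^+ p - x; y ^+ p; z ^+ p].

Definition B3_rels : set (free_alg k 3) :=
  [set bracket x y - y; bracket x z - z; bracket y z - y ^+ 2;
       x ^+ p - x; y ^+ p; z ^+ p].

Definition C16_rels (lambda delta : k) : set (free_alg k 3) :=
  [set bracket x y; bracket x z - lambda *: x; bracket y z - lambda^-1 *: y;
       x ^+ p; y ^+ p; z ^+ p - delta *: z].

End Presentations.

Arguments B1_rels k p _ : clear implicits.
Arguments C11_rels k p _ : clear implicits.
Arguments B3_rels k p _ : clear implicits.
Arguments C16_rels k p lambda delta _ : clear implicits.

Definition expgz (gT : finGroupType) (g : gT) (a : int) : gT :=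
  match a with Posz n => (g ^+ n)%g | Negz n => (g ^- n.+1)%g end.

(* Main.v *)
From HB Require Import structures.
Require Import Defs.
From mathcomp Require Import all_boot all_order all_fingroup all_algebra.
From mathcomp Require Import cyclic boolp classical_sets.
From mathcomp Require Import finmap monalg.

Set Implicit Arguments.
Unset Strict Implicit.
Unset Printing Implicit Defensive.

Import GRing.Theory.

Local Open Scope ring_scope.

(** Let [h = x] in (a) and (b), and [h = z / lambda] in (c).  In each algebra
    [h ^+ p = h], so [h] is diagonalizable with eigenvalues in the prime field,
    and the other two generators satisfy the relations of the local algebra and
    shift the eigenvalues of [h] by constants.  A character [chi : gT -> k] with
    [chi sigma = 1] identifies [gT] with the prime field; the spectral
    idempotents [1 - (h - chi g) ^+ p.-1] are then the vertices of the covering,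
    and the products [y * idem g], [z * idem g] are its arrows.  Conversely the
    covering contains [h = \sum_g chi g *: e_g] and the sums of the lifts of [y]
    and [z].  So both algebras have the universal property of a triple
    [(h, y, z)] subject to these relations, and are therefore isomorphic. *)

(** * Homomorphisms out of free algebras, path algebras and their quotients *)

(** No basis or dimension is computed: the two universal properties yield maps in both directions,
    and uniqueness makes them mutually inverse. The computation lies in reading off the weights. A
    relation [h * y = y * h + alpha *: y] sends the eigenspace of [c] to that of [c + alpha], so an
    arrow of weight [g] corresponds to [alpha = chi g]. In (c), [x,z] = lambda x gives h x = x h -
    x, whence the weight sigma^-1, and [y,z] = lambda^-1 y gives h y = y h - lambda^-2 y. For
    lambda^-2 to come from an element of the group it must lie in the prime field, which follows
    from (lambda^-2)^(p-1) = delta^-2 = 1; the integer [a] is then its logarithm. Admissibility of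
    the local algebras is part of the claim, and is obtained by showing that every path of length at
    least 2p vanishes in them. *)

Section AlgQuotTheory.
Variables (k : fieldType) (A : algType k) (S : set A).
Implicit Types (u v : alg_quot S).

Lemma alg_pi_zmod_morphism : zmod_morphism (@alg_pi k A S).
Proof.
by move=> x y; apply: (addIr (alg_pi S y)); rewrite -alg_piD !subrK.
Qed.

Lemma alg_pi_monoid_morphism : monoid_morphism (@alg_pi k A S).
Proof. by split=> // x y; apply/esym/alg_pi_mul. Qed.

HB.instance Definition _ :=
  GRing.isZmodMorphism.Build A (alg_quot S) (@alg_pi k A S) alg_pi_zmod_morphism.
HB.instance Definition _ :=
  GRing.isMonoidMorphism.Build A (alg_quot S) (@alg_pi k A S)
    alg_pi_monoid_morphism.

Lemma alg_piZ : scalable (@alg_pi k A S).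
Proof. by move=> a x; apply/esym/alg_pi_scale. Qed.

Lemma alg_pi_eq0 x : (alg_pi S x = 0) <-> ideal_gen S x.
Proof.
rewrite -(raddf0 (@alg_pi k A S)).
by split=> [/eqP/alg_piP|Sx]; [|apply/eqP/alg_piP]; rewrite subr0.
Qed.

(** A quotient may be the zero ring, so [alg_quot S] carries only a ring and a module structure.
    Scalars move through products by these lemmas. *)
Lemma quot_scaleAl a u v : (a *: u) * v = a *: (u * v).
Proof. by rewrite [RHS]alg_quot_scaleAl. Qed.

Lemma quot_scaleAr a u v : u * (a *: v) = a *: (u * v).
Proof. by rewrite [RHS]alg_quot_scaleAr. Qed.

Lemma quot_scaleMM a b u v : (a *: u) * (b *: v) = (a * b) *: (u * v).
Proof. by rewrite quot_scaleAl quot_scaleAr scalerA. Qed.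

Lemma quot_exprZ a u n : (a *: u) ^+ n = a ^+ n *: u ^+ n.
Proof.
elim: n => [|n IHn]; first by rewrite !expr0 scale1r.
by rewrite !exprS IHn quot_scaleMM.
Qed.

Lemma alg_quot_lift (A' : algType k) (S' : set A')
    (f : {rmorphism A -> alg_quot S'}) :
  scalable f -> (forall x, S x -> f x = 0) ->
  exists g : {rmorphism alg_quot S -> alg_quot S'},
    scalable g /\ forall x, g (alg_pi S x) = f x.
Proof.
move=> fZ fS; pose g u := f (generic_quotient.repr u).
(* Since [g] evaluates [f] at a chosen representative, everything rests on [f] killing the whole
   ideal. *)
have f0 x : ideal_gen S x -> f x = 0.
  elim=> {x} [x /fS->//||x y _ fx _ fy|a x _ fx|a x _ fx].
  - exact: rmorph0.
  - by rewrite rmorphD fx fy addr0.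
  - by rewrite rmorphM fx mulr0.
  - by rewrite rmorphM fx mul0r.
have gE x : g (alg_pi S x) = f x.
  by apply/eqP; rewrite -subr_eq0 -rmorphB f0 //; apply/alg_piP; rewrite alg_piK.
have gB : zmod_morphism g.
  by elim/alg_pi_ind=> x; elim/alg_pi_ind=> y; rewrite -rmorphB !gE rmorphB.
have gM : monoid_morphism g.
  split; first by rewrite -(rmorph1 (@alg_pi k A S)) gE rmorph1.
  by elim/alg_pi_ind=> x; elim/alg_pi_ind=> y; rewrite -rmorphM !gE rmorphM.
pose gz := GRing.isZmodMorphism.Build _ _ g gB.
pose gm := GRing.isMonoidMorphism.Build _ _ g gM.
pose G : {rmorphism alg_quot S -> alg_quot S'} := HB.pack g gz gm.
exists G; split=> // a; elim/alg_pi_ind=> x.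
by rewrite /= -alg_piZ !gE fZ.
Qed.

End AlgQuotTheory.

Section LinearExtension.
Variables (k : fieldType) (K : choiceType) (V : lmodType k) (h : K -> V).
Implicit Types g : {malg k[K]}.

Definition malg_ext g : V := \sum_(q <- msupp g) g@_q *: h q.

Lemma malg_extw (d : {fset K}) g :
  (msupp g `<=` d)%fset -> malg_ext g = \sum_(q <- d) g@_q *: h q.
Proof.
move=> le_d; rewrite /malg_ext (big_fset_incl _ le_d) //= => q _.
by move/mcoeff_outdom->; rewrite scale0r.
Qed.

Lemma malg_extU c q : malg_ext << c *g q >> = c *: h q.
Proof. by rewrite (malg_extw msuppU_le) big_seq_fset1 mcoeffUU. Qed.

Lemma malg_extZ : scalable malg_ext.
Proof.
move=> a g; rewrite (malg_extw (msuppZ_le a g)) /malg_ext scaler_sumr.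
by apply: eq_bigr => q _; rewrite mcoeffZ scalerA.
Qed.

Lemma malg_extD : {morph malg_ext : g1 g2 / g1 + g2}.
Proof.
move=> g1 g2; rewrite (malg_extw (msuppD_le _ _)).
rewrite (malg_extw (fsubsetUl _ (msupp g2))).
rewrite (malg_extw (fsubsetUr (msupp g1) _)) -big_split /=.
by apply: eq_bigr => q _; rewrite mcoeffD scalerDl.
Qed.

End LinearExtension.

Section MalgHom.
Variables (k : fieldType) (K : choiceType).

Lemma malg_ext_unique (V : lmodType k) (f g : {additive {malg k[K]} -> V}) :
  scalable f -> scalable g -> (forall q, f << q >> = g << q >>) -> f =1 g.
Proof.
move=> fZ gZ fg x; rewrite [x]monalgE !raddf_sum; apply: eq_bigr => q _.
by rewrite -[x@_q]mulr1 -malg_scaleU fZ gZ fg.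
Qed.

Lemma malg_ind (P : {malg k[K]} -> Prop) : P 0 ->
    (forall x y, P x -> P y -> P (x + y)) -> (forall c q, P << c *g q >>) ->
  forall x, P x.
Proof. by move=> P0 PD PU x; rewrite [x]monalgE; apply: big_ind. Qed.

(* [m] is the product of an algebra carried by [{malg k[K]}]: the path
   algebra and the free algebra are both treated at once. *)
Lemma malg_ext_morph (A : algType k) (S : set A) (h : K -> alg_quot S)
    (m : {malg k[K]} -> {malg k[K]} -> {malg k[K]}) :
  left_distributive m +%R -> right_distributive m +%R ->
  (forall c d q r, malg_ext h (m << c *g q >> << d *g r >>)
     = (c * d) *: (h q * h r)) ->
  {morph malg_ext h : x y / m x y >-> x * y}.
Proof.
move=> mDl mDr mU.
have ext0 : malg_ext h 0 = 0.
  by have := malg_extZ h 0 0; rewrite !scale0r.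
have m0l x : m 0 x = 0.
  by apply: (addrI (m 0 x)); rewrite -mDl !addr0.
have m0r x : m x 0 = 0.
  by apply: (addrI (m x 0)); rewrite -mDr !addr0.
elim/malg_ind=> [y|x x' IHx IHx' y|c q].
- by rewrite m0l ext0 mul0r.
- by rewrite mDl !malg_extD IHx IHx' mulrDl.
elim/malg_ind=> [|x x' IHx IHx'|d r].
- by rewrite m0r ext0 mulr0.
- by rewrite mDr !malg_extD IHx IHx' mulrDr.
- by rewrite mU !malg_extU quot_scaleMM.
Qed.

End MalgHom.

Section FreeAlgHom.
Variables (k : fieldType) (n : nat) (A : algType k) (S : set A).

Lemma free_alg_hom (u : 'I_n -> alg_quot S) :
  exists f : {rmorphism free_alg k n -> alg_quot S},
    scalable f /\ forall i, f (free_gen k i) = u i.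
Proof.
pose h (m : {fmonom 'I_n}) := \prod_(i <- m) u i.
pose f : free_alg k n -> alg_quot S := malg_ext h.
have fB : zmod_morphism f.
  move=> x y; rewrite /f malg_extD -scaleN1r malg_extZ.
  by rewrite scaleN1r.
have fM : monoid_morphism f.
  split; first by rewrite /f malg_extU scale1r /h fm1 big_nil.
  apply: malg_ext_morph => [x y z|x y z|c d q r].
  - exact: mulrDl.
  - exact: mulrDr.
  - by rewrite malgM_def (fgmulUU) malg_extU /h fmM big_cat.
pose fz := GRing.isZmodMorphism.Build _ _ f fB.
pose fm := GRing.isMonoidMorphism.Build _ _ f fM.
pose F : {rmorphism free_alg k n -> alg_quot S} := HB.pack f fz fm.
exists F; split=> [|i]; first exact: malg_extZ.
by rewrite /= /f /free_gen malg_extU scale1r /h fmU big_seq1.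
Qed.

Lemma free_alg_hom_unique (f g : {rmorphism free_alg k n -> alg_quot S}) :
  scalable f -> scalable g ->
  (forall i, f (free_gen k i) = g (free_gen k i)) -> f =1 g.
Proof.
move=> fZ gZ fg.
suffices fgU m : f << m >> = g << m >> by apply: malg_ext_unique.
case: m; elim=> [|i s IHs].
  have -> : << FMonom [::] : {fmonom 'I_n} >> = 1 :> free_alg k n.
    by congr << _ >>; apply: val_inj; rewrite /= fm1.
  by rewrite !rmorph1.
have -> : << FMonom (i :: s) : {fmonom 'I_n} >>
          = free_gen k i * << FMonom s >> :> free_alg k n.
  rewrite [RHS]malgM_def [RHS]fgmulUU mulr1.
  by congr << _ >>; apply: val_inj; rewrite /= fmM fmU.
by rewrite !rmorphM fg IHs.
Qed.

End FreeAlgHom.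

Section PathAlgHom.
Variables (k : fieldType) (Q : quiver).

Definition path_elt (q : qpath Q) : path_alg k Q := << q >>.
Definition vert_elt (v : vert Q) : path_alg k Q := << trivial_path v >>.

(** The induction removes the first arrow traversed, that is the rightmost factor, because the arrow
    sequence of a path lists its arrows in order of traversal. *)
Lemma qpath_ind (P : qpath Q -> Prop) :
  (forall v, P (trivial_path v)) ->
  (forall a q s, qpath_comp q (arr_path a) = Some s -> P q -> P s) ->
  forall q, P q.
Proof.
move=> P1 PM [[v s] Hs]; elim: s v Hs => [|a s IHs] v Hs /=.
  by have -> : QPath Hs = trivial_path v by exact: val_inj.
have /andP[/eqP ov walk_s] : (org a == v) && walk (ter a) s := Hs.
have {}IHs := IHs (ter a) walk_s.
apply: (PM a _ _ _ IHs); case: pcompP => [t _ ot at_ _|/=]; last first.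
  by rewrite /pter /walk_end /= /porg /=.
by congr Some; apply: qpath_inj; rewrite ?ot ?at_.
Qed.

Lemma path_eltM (q r : qpath Q) :
  path_elt q * path_elt r = omono 1 (qpath_comp q r).
Proof. by rewrite [LHS]path_mulUU mulr1. Qed.

Lemma path_alg1 : (1 : path_alg k Q) = \sum_v vert_elt v.
Proof. by []. Qed.

Lemma path_alg_hom_unique (A : algType k) (S : set A)
    (f g : {rmorphism path_alg k Q -> alg_quot S}) :
  scalable f -> scalable g -> (forall v, f (vert_elt v) = g (vert_elt v)) ->
  (forall a, f (arr_elt k a) = g (arr_elt k a)) -> f =1 g.
Proof.
move=> fZ gZ fv fa.
suffices fgU q : f (path_elt q) = g (path_elt q).
  by apply: (@malg_ext_unique k _ (alg_quot S) f g).
elim/qpath_ind: q => // a q s qa.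
have -> : path_elt s = path_elt q * arr_elt k a by rewrite path_eltM qa.
by rewrite !rmorphM fa => ->.
Qed.

Section Existence.
Variables (A : algType k) (S : set A).
Variables (e : vert Q -> alg_quot S) (f : arr Q -> alg_quot S).
Hypothesis eM : forall u v, e u * e v = if u == v then e u else 0.
Hypothesis e_sum : \sum_v e v = 1.
Hypothesis fe : forall a, f a * e (org a) = f a.
Hypothesis ef : forall a, e (ter a) * f a = f a.

Let walk_val := fix walk_val (v : vert Q) (s : seq (arr Q)) :=
  if s is a :: s' then walk_val (ter a) s' * f a else e v.

Let walk_val_org v s : walk v s -> walk_val v s * e v = walk_val v s.
Proof.
case: s => [|a s] /=; first by rewrite eM eqxx.
by case/andP=> /eqP<- _; rewrite -mulrA fe.
Qed.

Let walk_val_ter v s : walk v s -> e (walk_end v s) * walk_val v s = walk_val v s.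
Proof.
elim: s v => [|a s IHs] v /=; first by rewrite eM eqxx.
by case/andP=> _ /IHs; rewrite mulrA => ->.
Qed.

Let walk_val_cat v s t : walk v s -> walk (walk_end v s) t ->
  walk_val v (s ++ t) = walk_val (walk_end v s) t * walk_val v s.
Proof.
elim: s v => [|a s IHs] v /=; first by move=> _ /walk_val_org.
by case/andP=> _ ws wt; rewrite (IHs (ter a)) // mulrA.
Qed.

(** The section hypotheses are the defining relations of the path algebra: orthogonal idempotents
    with sum 1, and arrows fixed by the idempotents at their two ends. *)
Lemma path_alg_hom :
  exists F : {rmorphism path_alg k Q -> alg_quot S},
    [/\ scalable F, forall v, F (vert_elt v) = e v
      & forall a, F (arr_elt k a) = f a].
Proof.
pose h (q : qpath Q) := walk_val (porg q) (parrs q).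
pose F : path_alg k Q -> alg_quot S := malg_ext h.
have FB : zmod_morphism F.
  by move=> x y; rewrite /F malg_extD -scaleN1r malg_extZ scaleN1r.
have Fv v : F (vert_elt v) = e v by rewrite /F malg_extU scale1r.
pose Fz := GRing.isZmodMorphism.Build _ _ F FB.
pose Fa : {additive path_alg k Q -> alg_quot S} := HB.pack F Fz.
have FM : monoid_morphism F.
  split.
    rewrite path_alg1 -e_sum -[F]/(Fa : _ -> _) raddf_sum.
    by apply: eq_bigr => v _; apply: Fv.
  apply: malg_ext_morph => [x y z|x y z|c d q r].
  - exact: path_mulDl.
  - exact: path_mulDr.
  rewrite [_ * _ in LHS]path_mulUU; case: pcompP => [s qr os as_ _|ne] /=.
    by rewrite malg_extU /h os as_ walk_val_cat -?/(pter r) ?qr ?qpathP.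
  rewrite -[malg_ext h 0]/(Fa 0) raddf0.
  (* For paths that do not compose, the idempotents at the terminus of [r] and at the origin of [q]
     are inserted between the factors; being orthogonal, they kill the product. *)
  rewrite /h -(walk_val_org (qpathP q)) -(walk_val_ter (qpathP r)).
  rewrite -mulrA (mulrA (e _)) eM eq_sym (introF eqP ne).
  by rewrite mul0r mulr0 scaler0.
pose Fm := GRing.isMonoidMorphism.Build _ _ F FM.
pose F' : {rmorphism path_alg k Q -> alg_quot S} := HB.pack F Fz Fm.
exists F'; split=> [||a]; [exact: malg_extZ | exact: Fv |].
by rewrite /= /F malg_extU scale1r /h /= ef.
Qed.

End Existence.

End PathAlgHom.

(** * Spectral idempotents *)

Section Evaluation.
Variables (k : fieldType) (A : algType k) (S : set A) (u : alg_quot S).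

(** The polynomial is evaluated in [A], at a representative, and then projected, because
    [horner_alg] expects an algebra structure and the quotient is only a ring and a module. *)
Definition quot_horner (q : {poly k}) : alg_quot S :=
  alg_pi S (horner_alg (generic_quotient.repr u) q).

Lemma quot_horner_zmod_morphism : zmod_morphism quot_horner.
Proof. by move=> q r; rewrite /quot_horner !rmorphB. Qed.

Lemma quot_horner_monoid_morphism : monoid_morphism quot_horner.
Proof. by split=> [|q r]; rewrite /quot_horner ?rmorph1 // !rmorphM. Qed.

HB.instance Definition _ :=
  GRing.isZmodMorphism.Build {poly k} (alg_quot S) quot_horner
    quot_horner_zmod_morphism.
HB.instance Definition _ :=
  GRing.isMonoidMorphism.Build {poly k} (alg_quot S) quot_horner
    quot_horner_monoid_morphism.

Lemma quot_hornerX : quot_horner 'X = u.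
Proof. by rewrite /quot_horner /= horner_algX alg_piK. Qed.

Lemma quot_hornerC c : quot_horner c%:P = c *: (1 : alg_quot S).
Proof. by rewrite /quot_horner /= horner_algC alg_piZ rmorph1. Qed.

Lemma quot_horner_eigen (c : k) (v : alg_quot S) (q : {poly k}) :
  u * v = c *: v -> quot_horner q * v = q.[c] *: v.
Proof.
move=> uv; elim/poly_ind: q => [|q d IHq].
  by rewrite rmorph0 horner0 mul0r scale0r.
rewrite rmorphD rmorphM /= quot_hornerX quot_hornerC hornerMXaddC scalerDl mulrDl.
by rewrite -mulrA uv quot_scaleAr IHq scalerA mulrC quot_scaleAl mul1r.
Qed.

(** The hypothesis amounts to (u - (c + d)) v = v (u - c), which is then iterated. *)
Lemma quot_horner_shift (c d : k) (v : alg_quot S) n :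
  u * v = v * u + d *: v ->
  quot_horner (('X - (c + d)%:P) ^+ n) * v
  = v * quot_horner (('X - c%:P) ^+ n).
Proof.
move=> uv.
have uv1 : quot_horner ('X - (c + d)%:P) * v = v * quot_horner ('X - c%:P).
  rewrite !rmorphB /= !quot_hornerX !quot_hornerC mulrBl mulrBr uv.
  rewrite quot_scaleAl quot_scaleAr mul1r mulr1 scalerDl.
  by rewrite opprD addrACA subrr addr0.
elim: n => [|n IHn]; first by rewrite !rmorph1 mulr1 mul1r.
by rewrite exprSr exprSr !rmorphM /= -mulrA uv1 !mulrA IHn.
Qed.

End Evaluation.

Lemma quot_horner_map (k : fieldType) (A A' : algType k) (S : set A)
    (S' : set A') (f : {rmorphism alg_quot S -> alg_quot S'}) u q :
  scalable f -> f (quot_horner u q) = quot_horner (f u) q.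
Proof.
move=> fZ; elim/poly_ind: q => [|q c IHq]; first by rewrite !rmorph0.
rewrite [quot_horner u _]rmorphD [quot_horner (f u) _]rmorphD !rmorphM /=.
by rewrite !quot_hornerX !quot_hornerC rmorphD rmorphM IHq fZ rmorph1.
Qed.

Section PrimeFieldIdempotents.
Variables (p : nat) (k : fieldType).
Hypotheses (p_prime : prime p) (k_char : p \in [pchar k]).
Implicit Types c d : k.

(* Lagrange polynomial of [c] on the points of the prime field, as
   [d ^+ p.-1 = 1] for [d != 0] in the prime field. *)
Definition delta_poly c : {poly k} := 1 - ('X - c%:P) ^+ p.-1.

Let expB (R : comNzRingType) (x y : R) :
  p \in [pchar R] -> (x - y) ^+ p = x ^+ p - y ^+ p.
Proof. by move=> chR; apply: (pFrobenius_autB_comm chR); apply: mulrC. Qed.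

(** By Frobenius, (X - c)^p = X^p - c. The right-hand side is the same for every [c], so the single
    equation [u ^+ p = u] makes every [idem g] an eigenvector of [u]. *)
Lemma mulX_delta_poly c : c ^+ p = c ->
  ('X - c%:P) * delta_poly c = 'X - 'X ^+ p.
Proof.
move=> cp; rewrite mulrBr mulr1 -exprS prednK ?prime_gt0 //.
rewrite expB ?pchar_lalg // -rmorphXn /= cp.
by rewrite opprB addrA subrK.
Qed.

Lemma horner_delta_poly c d : c ^+ p = c -> d ^+ p = d ->
  (delta_poly c).[d] = (c == d)%:R.
Proof.
move=> cp dp; rewrite !hornerE /=.
have [->|ne_cd] := eqVneq c d.
  (* The power of zero vanishes because [p.-1] is positive. *)
  by rewrite subrr expr0n -subn1 subn_eq0 leqNgt prime_gt1 // subr0.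
have ne0 : d - c != 0 by rewrite subr_eq0 eq_sym.
suff -> : (d - c) ^+ p.-1 = 1 by rewrite subrr.
apply: (mulfI ne0); rewrite -exprS prednK ?prime_gt0 // mulr1.
by rewrite expB // dp cp.
Qed.

Variables (gT : finGroupType) (chi : gT -> k).
Hypotheses (chi_inj : injective chi) (chi_p : forall g, chi g ^+ p = chi g).
Hypothesis gT_card : #|gT| = p.

(** The difference of the two sides has degree less than [p] and vanishes at the [p] distinct points
    [chi g]. *)
Lemma delta_poly_sum : \sum_g delta_poly (chi g) = 1.
Proof.
apply/eqP; rewrite -subr_eq0; set q := _ - 1.
have size_q : (size q <= p)%N.
  rewrite (leq_trans (size_polyD _ _)) // size_polyN size_poly1 geq_max.
  rewrite prime_gt0 // andbT (leq_trans (size_sum _ _ _)) //.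
  apply/bigmax_leqP => g _; rewrite (leq_trans (size_polyD _ _)) //.
  rewrite size_poly1 size_polyN geq_max prime_gt0 //=.
  by rewrite size_exp_XsubC prednK ?prime_gt0.
apply: contraLR size_q => nz_q; rewrite -ltnNge -gT_card cardE -(size_map chi).
apply: max_poly_roots => //; last by rewrite map_inj_uniq ?enum_uniq.
apply/allP => _ /mapP[g _ ->]; rewrite /root /q hornerD hornerN hornerC.
rewrite horner_sum (bigD1 g) //= horner_delta_poly // eqxx.
rewrite big1 ?addr0 ?subrr // => h ne_hg.
by rewrite horner_delta_poly // inj_eq // (negbTE ne_hg).
Qed.

Section Idempotents.
Variables (A : algType k) (S : set A) (u : alg_quot S).
Hypothesis up : u ^+ p = u.

Definition idem (g : gT) : alg_quot S := quot_horner u (delta_poly (chi g)).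

Lemma mul_idem g : u * idem g = chi g *: idem g.
Proof.
apply/eqP; rewrite -subr_eq0; apply/eqP.
have : quot_horner u ('X - (chi g)%:P) * idem g = 0.
  rewrite -rmorphM mulX_delta_poly // rmorphB (rmorphXn (quot_horner u)) /=.
  by rewrite quot_hornerX up subrr.
by rewrite rmorphB /= quot_hornerX quot_hornerC mulrBl quot_scaleAl mul1r.
Qed.

(** On the eigenvector [idem h] the polynomial in [u] defining [idem g] acts by its value at
    [chi h], which is 0 or 1. *)
Lemma idemM g h : idem g * idem h = if g == h then idem g else 0.
Proof.
rewrite [LHS](quot_horner_eigen _ (mul_idem h)) horner_delta_poly //.
by rewrite inj_eq //; case: eqP => [->|_]; rewrite ?scale1r ?scale0r.
Qed.

Lemma idem_sum : \sum_g idem g = 1.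
Proof. by rewrite -rmorph_sum delta_poly_sum rmorph1. Qed.

Lemma idem_expand : \sum_g chi g *: idem g = u.
Proof.
rewrite -[RHS]mulr1 -idem_sum mulr_sumr.
by apply: eq_bigr => g _; rewrite mul_idem.
Qed.

(** An element that raises the eigenvalue of [u] by [chi h] carries the eigenspace of [g] into that
    of [g * h], as the arrows of the covering quiver do. *)
Lemma idem_shift g h v : chi (g * h)%g = chi g + chi h ->
  u * v = v * u + chi h *: v -> idem (g * h)%g * v = v * idem g.
Proof.
move=> chiM uv; rewrite /idem /delta_poly chiM !rmorphB !rmorph1 mulrBl mulrBr.
by rewrite mul1r mulr1 (quot_horner_shift _ _ uv).
Qed.

(** Any decomposition of 1 into eigenvectors for the eigenvalues [chi g] is the spectral one. This
    identifies the idempotents of [cov_gen] with sums of vertices of the covering. *)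
Lemma idem_unique (E : gT -> alg_quot S) :
  (forall g, u * E g = chi g *: E g) -> \sum_g E g = 1 -> forall g, idem g = E g.
Proof.
move=> uE E_sum g; rewrite -[LHS]mulr1 -E_sum mulr_sumr (bigD1 g) //=.
rewrite [X in X + _](quot_horner_eigen _ (uE g)) horner_delta_poly // eqxx.
rewrite scale1r big1 ?addr0 // => h ne_hg.
rewrite [LHS](quot_horner_eigen _ (uE h)) horner_delta_poly // inj_eq //.
by rewrite eq_sym (negbTE ne_hg) scale0r.
Qed.

End Idempotents.
End PrimeFieldIdempotents.

(** * The covering as a universal algebra *)

Section LiftPath.
Variables (Q : quiver) (gT : finGroupType) (w : arr Q -> gT).

Lemma pter_lift_path g q : pter (lift_path w g q) = (pter q, (g * weight w q)%g).
Proof.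
case: q => [[v s] Hs]; rewrite /pter /weight /walk_end /porg /parrs /=.
elim: s v g Hs => [|a s IHs] v g Hs; first by rewrite /= big_nil mulg1.
have /andP[_ walk_s] : (org a == v) && walk (ter a) s := Hs.
by rewrite /= (IHs (ter a)) // big_cons mulgA.
Qed.

Lemma lift_walk_cat g s t :
  lift_walk w g (s ++ t)
  = lift_walk w g s ++ lift_walk w (g * \prod_(a <- s) w a)%g t.
Proof.
elim: s g => [|a s IHs] g /=; first by rewrite big_nil mulg1.
by rewrite IHs big_cons mulgA.
Qed.

Lemma weight_arr_path a : weight w (arr_path a) = w a.
Proof. by rewrite /weight /= big_seq1. Qed.

(** The lift of [q] has to start where that of [r] ends, hence its base point [g * weight w r]. *)
Lemma lift_path_comp g q r s : qpath_comp q r = Some s ->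
  qpath_comp (lift_path w (g * weight w r)%g q) (lift_path w g r)
  = Some (lift_path w g s).
Proof.
case: pcompP => // s' qr os as_ _ [<-].
case: pcompP => [t _ ot at_ _|]; last first.
  by rewrite pter_lift_path /porg /= -/(porg q) qr.
congr Some; apply: qpath_inj; first by rewrite ot /porg /= -/(porg s') os.
by rewrite at_ /parrs /= -/(parrs q) -/(parrs r) -/(parrs s') as_ lift_walk_cat.
Qed.

Lemma lift_trivial_path (k : fieldType) g v :
  path_elt k (lift_path w g (trivial_path v))
  = vert_elt k ((v, g) : vert (covering_quiver w)).
Proof. by congr << _ >>; apply: val_inj. Qed.

End LiftPath.

Section PathElements.
Variables (k : fieldType) (Q : quiver).

Lemma arr_eltE (a : arr Q) : arr_elt k a = path_elt k (arr_path a).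
Proof. by []. Qed.

Lemma vert_eltM (u v : vert Q) :
  vert_elt k u * vert_elt k v = if u == v then vert_elt k u else 0.
Proof.
rewrite path_eltM pcomp1q /pter /=; rewrite eq_sym.
by case: eqP => [->|].
Qed.

Lemma arr_elt_org (a : arr Q) : arr_elt k a * vert_elt k (org a) = arr_elt k a.
Proof. by rewrite [LHS]path_eltM pcompq1 eqxx. Qed.

Lemma arr_elt_ter (a : arr Q) : vert_elt k (ter a) * arr_elt k a = arr_elt k a.
Proof. by rewrite [LHS]path_eltM pcomp1q eqxx. Qed.

Lemma path_eltZ c (q : qpath Q) : << c *g q >> = c *: path_elt k q.
Proof. by rewrite [RHS]malg_scaleU mulr1. Qed.

Lemma path_homE (A : algType k) (S : set A)
    (f : {rmorphism path_alg k Q -> alg_quot S}) (r : path_alg k Q) :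
  scalable f -> f r = \sum_(q <- msupp r) r@_q *: f (path_elt k q).
Proof.
move=> fZ; rewrite {1}[r]monalgE; apply: (etrans (raddf_sum f _ _ _)).
by apply: eq_bigr => q _; rewrite -fZ; congr (f _); apply: path_eltZ.
Qed.

End PathElements.

Section Crossed.
Variables (p : nat) (k : fieldType) (gT : finGroupType) (chi : gT -> k).
Variables (Q : quiver) (w : arr Q -> gT).

(* [phi] and [h] define a representation of the crossed product of
   [kQ] by [k[h]/(h^p - h)] in which an arrow [a] shifts [h] by [chi (w a)]. *)
Definition crossed (A : algType k) (S : set A)
    (phi : {rmorphism path_alg k Q -> alg_quot S}) (h : alg_quot S) : Prop :=
  [/\ h ^+ p = h, forall v, h * phi (vert_elt k v) = phi (vert_elt k v) * h
    & forall a, h * phi (arr_elt k a)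
                = phi (arr_elt k a) * h + chi (w a) *: phi (arr_elt k a)].

End Crossed.

(** * Systems of vertices and arrows indexed by the group *)

Section CompleteSystem.
Variables (p : nat) (k : fieldType).
Hypotheses (p_prime : prime p) (k_char : p \in [pchar k]).
Variables (gT : finGroupType) (chi : gT -> k).
Hypotheses (chi_inj : injective chi) (chi_p : forall g, chi g ^+ p = chi g).
Hypothesis chiM : forall g h, chi (g * h)%g = chi g + chi h.
Hypothesis gT_card : #|gT| = p.
Variables (A : algType k) (S : set A) (Q : quiver) (w : arr Q -> gT).
Variables (cov_vert : vert Q -> gT -> alg_quot S).
Variables (cov_arr : arr Q -> gT -> alg_quot S).
Hypothesis cov_vertM : forall u v g h, cov_vert u g * cov_vert v h
  = if (u == v) && (g == h) then cov_vert u g else 0.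
Hypothesis cov_vert_sum : \sum_g \sum_v cov_vert v g = 1.
Hypothesis cov_arr_org : forall a g,
  cov_arr a g * cov_vert (org a) g = cov_arr a g.
Hypothesis cov_arr_ter : forall a g,
  cov_vert (ter a) (g * w a)%g * cov_arr a g = cov_arr a g.

Definition cov_idem (g : gT) : alg_quot S := \sum_v cov_vert v g.
Definition cov_gen : alg_quot S := \sum_g chi g *: cov_idem g.

Lemma cov_arr_vert a g v h :
  cov_arr a g * cov_vert v h
  = if (org a == v) && (g == h) then cov_arr a g else 0.
Proof.
by rewrite -{1}cov_arr_org -mulrA cov_vertM; case: ifP => _ //; rewrite mulr0.
Qed.

Lemma cov_vert_arr a g v h :
  cov_vert v h * cov_arr a g
  = if (v == ter a) && (h == g * w a)%g then cov_arr a g else 0.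
Proof.
rewrite -{1}cov_arr_ter mulrA cov_vertM.
by case: ifP => [/andP[/eqP-> /eqP->]|_] //; rewrite mul0r.
Qed.

Lemma cov_idem_sum : \sum_g cov_idem g = 1.
Proof. exact: cov_vert_sum. Qed.

Lemma cov_vert_idem v g h :
  cov_vert v g * cov_idem h = if g == h then cov_vert v g else 0.
Proof.
rewrite mulr_sumr (bigD1 v) //= cov_vertM eqxx /= big1 ?addr0 // => u ne_u.
by rewrite cov_vertM eq_sym (negbTE ne_u).
Qed.

Lemma cov_idem_vert v g h :
  cov_idem h * cov_vert v g = if h == g then cov_vert v g else 0.
Proof.
rewrite mulr_suml (bigD1 v) //= cov_vertM eqxx /= big1 ?addr0.
  by case: eqP => [->|].
by move=> u ne_u; rewrite cov_vertM (negbTE ne_u).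
Qed.

Lemma cov_arr_idem a g h :
  cov_arr a g * cov_idem h = if g == h then cov_arr a g else 0.
Proof.
rewrite mulr_sumr (bigD1 (org a)) //= cov_arr_vert eqxx /= big1 ?addr0 //.
move=> u ne_u.
by rewrite cov_arr_vert eq_sym (negbTE ne_u).
Qed.

Lemma cov_idem_arr a g h :
  cov_idem h * cov_arr a g = if h == (g * w a)%g then cov_arr a g else 0.
Proof.
rewrite mulr_suml (bigD1 (ter a)) //= cov_vert_arr eqxx /= big1 ?addr0 //.
by move=> u ne_u; rewrite cov_vert_arr (negbTE ne_u).
Qed.

Lemma cov_gen_vert v g : cov_gen * cov_vert v g = chi g *: cov_vert v g.
Proof.
rewrite mulr_suml (bigD1 g) //= quot_scaleAl cov_idem_vert eqxx big1 ?addr0 //.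
by move=> h ne_h; rewrite quot_scaleAl cov_idem_vert (negbTE ne_h) scaler0.
Qed.

Lemma cov_vert_gen v g : cov_vert v g * cov_gen = chi g *: cov_vert v g.
Proof.
rewrite mulr_sumr (bigD1 g) //= quot_scaleAr cov_vert_idem eqxx big1 ?addr0 //.
by move=> h ne_h; rewrite quot_scaleAr cov_vert_idem eq_sym (negbTE ne_h) scaler0.
Qed.

Lemma cov_gen_arr a g : cov_gen * cov_arr a g = chi (g * w a)%g *: cov_arr a g.
Proof.
rewrite mulr_suml (bigD1 (g * w a)%g) //= quot_scaleAl cov_idem_arr eqxx.
rewrite big1 ?addr0 // => h ne_h.
by rewrite quot_scaleAl cov_idem_arr (negbTE ne_h) scaler0.
Qed.

Lemma cov_arr_gen a g : cov_arr a g * cov_gen = chi g *: cov_arr a g.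
Proof.
rewrite mulr_sumr (bigD1 g) //= quot_scaleAr cov_arr_idem eqxx big1 ?addr0 //.
by move=> h ne_h; rewrite quot_scaleAr cov_arr_idem eq_sym (negbTE ne_h) scaler0.
Qed.

Lemma cov_gen_idem g : cov_gen * cov_idem g = chi g *: cov_idem g.
Proof.
by rewrite mulr_sumr scaler_sumr; apply: eq_bigr => v _; apply: cov_gen_vert.
Qed.

Lemma cov_genX : cov_gen ^+ p = cov_gen.
Proof.
rewrite -[LHS]mulr1 -cov_idem_sum mulr_sumr; apply: eq_bigr => g _.
(* Writing the eigenvalue as [chi g ^+ p] gives both sides the same exponent, over which the
   induction runs. *)
rewrite -[in RHS]chi_p; elim: p => [|n IHn]; first by rewrite mul1r scale1r.
by rewrite exprSr -mulrA cov_gen_idem quot_scaleAr IHn scalerA -exprS.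
Qed.

Lemma idem_cov_gen g : idem p chi cov_gen g = cov_idem g.
Proof.
apply: (idem_unique p_prime k_char chi_inj chi_p) => [h|].
  exact: cov_gen_idem.
exact: cov_idem_sum.
Qed.

(** Summing over the group forgets the grading and leaves a representation of the original quiver,
    while [cov_gen] remembers the grading. The last two clauses recover the system by cutting with
    the idempotents, so nothing is lost. *)
Lemma complete_system_crossed :
  exists (phi : {rmorphism path_alg k Q -> alg_quot S}) (h : alg_quot S),
    [/\ scalable phi, crossed p chi w phi h,
        forall v g, cov_vert v g = phi (vert_elt k v) * idem p chi h g
      & forall a g, cov_arr a g = phi (arr_elt k a) * idem p chi h g].
Proof.
pose e v := \sum_g cov_vert v g; pose f a := \sum_g cov_arr a g.
have e_idem v g : e v * cov_idem g = cov_vert v g.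
  rewrite mulr_suml (bigD1 g) //= cov_vert_idem eqxx big1 ?addr0 // => h ne_h.
  by rewrite cov_vert_idem (negbTE ne_h).
have f_idem a g : f a * cov_idem g = cov_arr a g.
  rewrite mulr_suml (bigD1 g) //= cov_arr_idem eqxx big1 ?addr0 // => h ne_h.
  by rewrite cov_arr_idem (negbTE ne_h).
have ev u v g : e u * cov_vert v g = if u == v then cov_vert v g else 0.
  rewrite mulr_suml (bigD1 g) //= cov_vertM eqxx andbT big1 ?addr0.
    by case: eqP => [->|].
  by move=> h ne_h; rewrite cov_vertM (negbTE ne_h) andbF.
have eM u v : e u * e v = if u == v then e u else 0.
  rewrite mulr_sumr; under eq_bigr do rewrite ev.
  by case: eqP => [->|_] //; rewrite big1.
have e_sum : \sum_v e v = 1 by rewrite exchange_big.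
have fe a : f a * e (org a) = f a.
  rewrite mulr_suml; apply: eq_bigr => g _; rewrite mulr_sumr (bigD1 g) //=.
  rewrite cov_arr_org big1 ?addr0 // => h ne_h.
  by rewrite cov_arr_vert [g == h]eq_sym (negbTE ne_h) andbF.
have ef a : e (ter a) * f a = f a.
  rewrite mulr_sumr; apply: eq_bigr => g _.
  rewrite mulr_suml (bigD1 (g * w a)%g) //=.
  rewrite cov_arr_ter big1 ?addr0 // => h ne_h.
  by rewrite cov_vert_arr (negbTE ne_h) andbF.
have [phi [phiZ phiv phia]] := path_alg_hom eM e_sum fe ef.
exists phi, cov_gen; split=> [//||v g|a g].
- split=> [|v|a]; first exact: cov_genX.
    rewrite phiv mulr_sumr mulr_suml; apply: eq_bigr => g _.
    by rewrite cov_gen_vert cov_vert_gen.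
  rewrite phia mulr_sumr mulr_suml scaler_sumr -big_split.
  by apply: eq_bigr => g _; rewrite cov_gen_arr cov_arr_gen chiM scalerDl.
- by rewrite idem_cov_gen phiv e_idem.
- by rewrite idem_cov_gen phia f_idem.
Qed.

End CompleteSystem.

(** * Universal property of the covering *)

Section CoveringUniversal.
Variables (p : nat) (k : fieldType).
Hypotheses (p_prime : prime p) (k_char : p \in [pchar k]).
Variables (gT : finGroupType) (chi : gT -> k).
Hypotheses (chi_inj : injective chi) (chi_p : forall g, chi g ^+ p = chi g).
Hypothesis chiM : forall g h, chi (g * h)%g = chi g + chi h.
Hypothesis gT_card : #|gT| = p.
Variables (P : bound_quiver k) (w : arr (bq_quiver P) -> gT).

Local Notation Q := (bq_quiver P).
Local Notation CQ := (covering_quiver w).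
Local Notation C := (alg_quot (bq_rels (covering w))).
Local Notation piC := (alg_pi (bq_rels (covering w))).

(** The last clause is the point: by induction on paths, with idempotents moving past arrows by
    [idem_shift], a lift of [r] goes to [phi r] times an idempotent. So a relation of [P] holds
    under [phi] exactly when all its lifts hold, the idempotents having sum 1. *)
Lemma covering_path_hom (A : algType k) (S : set A)
    (phi : {rmorphism path_alg k Q -> alg_quot S}) (h : alg_quot S) :
  scalable phi -> crossed p chi w phi h ->
  exists F : {rmorphism path_alg k CQ -> alg_quot S},
    [/\ scalable F,
        forall v g, F (vert_elt k ((v, g) : vert CQ))
                    = phi (vert_elt k v) * idem p chi h g,
        forall a g, F (arr_elt k ((a, g) : arr CQ))
                    = phi (arr_elt k a) * idem p chi h g
      & forall g r, F (lift_elt w g r) = phi r * idem p chi h g].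
Proof.
move=> phiZ [hp hv ha].
(* Generalized, since unification would otherwise unfold [idem]. *)
have [eps epsE] : exists eps, eps = idem p chi h by exists (idem p chi h).
have chi1 : chi 1%g = 0 by apply: (addrI (chi 1%g)); rewrite -chiM mulg1 addr0.
have epsM g g' : eps g * eps g' = if g == g' then eps g else 0.
  by rewrite epsE; apply: idemM.
have eps_sum : \sum_g eps g = 1 by rewrite epsE; apply: idem_sum.
(* Commutation with a vertex is the shift by the identity of the group, where [chi] vanishes. *)
have eps_v g v : eps g * phi (vert_elt k v) = phi (vert_elt k v) * eps g.
  rewrite epsE -{1}[g]mulg1; apply: idem_shift; first by rewrite chi1 mulg1 addr0.
  by rewrite chi1 scale0r addr0.
have eps_a g a : eps (g * w a)%g * phi (arr_elt k a) = phi (arr_elt k a) * eps g.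
  by rewrite epsE; apply: idem_shift.
have eps_idem g : eps g * eps g = eps g by rewrite epsM eqxx.
have mul_shift (x y e1 e2 : alg_quot S) :
    e1 * y = y * e2 -> e2 * e2 = e2 -> (x * e1) * (y * e2) = (x * y) * e2.
  by move=> e1y e22; rewrite -mulrA (mulrA e1) e1y -!mulrA e22.
pose e (x : vert CQ) := phi (vert_elt k x.1) * eps x.2.
pose f (b : arr CQ) := phi (arr_elt k b.1) * eps b.2.
have eM x y : e x * e y = if x == y then e x else 0.
  case: x y => [u g] [v g']; rewrite /e /= -mulrA (mulrA (eps g)) eps_v -mulrA.
  rewrite epsM mulrA -rmorphM vert_eltM xpair_eqE.
  by case: (u == v); case: (g == g'); rewrite ?mulr0 ?rmorph0 ?mul0r.
have e_sum : \sum_x e x = 1.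
  rewrite -(pair_bigA _ (fun v g => phi (vert_elt k v) * eps g)) /=.
  under eq_bigr do rewrite -mulr_sumr eps_sum mulr1.
  by rewrite -rmorph_sum -path_alg1 rmorph1.
have fe b : f b * e (org b) = f b.
  case: b => a g; rewrite /f /e /= -mulrA (mulrA (eps g)) eps_v -mulrA epsM eqxx.
  by rewrite mulrA -rmorphM arr_elt_org.
have ef b : e (ter b) * f b = f b.
  case: b => a g; apply: (etrans (mul_shift _ _ _ _ (eps_a g a) (eps_idem g))).
  congr (_ * _).
  exact: (etrans (esym (rmorphM phi _ _)) (congr1 phi (arr_elt_ter k a))).
have [F [FZ Fv Fa]] := path_alg_hom eM e_sum fe ef.
have F_lift g q : F (path_elt k (lift_path w g q)) = phi (path_elt k q) * eps g.
  elim/qpath_ind: q g => [v|a q s qa IHq] g.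
    by rewrite lift_trivial_path (Fv (v, g)).
  have -> : path_elt k s = path_elt k q * arr_elt k a.
    by rewrite arr_eltE path_eltM qa.
  have -> : path_elt k (lift_path w g s)
      = path_elt k (lift_path w (g * w a)%g q) * arr_elt k ((a, g) : arr CQ).
    have -> : arr_elt k ((a, g) : arr CQ)
        = path_elt k (lift_path w g (arr_path a)).
      by rewrite arr_eltE; congr path_elt; apply: val_inj.
    by rewrite path_eltM -[w a]weight_arr_path (lift_path_comp _ _ qa).
  apply: (etrans (rmorphM F _ _)).
  apply: (etrans (congr2 *%R (IHq _) (Fa (a, g)))).
  apply: (etrans _ (congr1 ( *%R^~ (eps g)) (esym (rmorphM phi _ _)))).
  exact: mul_shift (eps_a g a) (eps_idem g).
exists F; rewrite -epsE; split=> [//|v g|a g|g r].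
- exact: (Fv (v, g)).
- exact: (Fa (a, g)).
rewrite (path_homE _ phiZ) mulr_suml.
apply: (etrans (raddf_sum F _ _ _)).
apply: eq_bigr => q _; rewrite quot_scaleAl -F_lift -FZ.
congr (F _); exact: path_eltZ.
Qed.

Lemma covering_hom (A : algType k) (S : set A)
    (phi : {rmorphism path_alg k Q -> alg_quot S}) (h : alg_quot S) :
  scalable phi -> crossed p chi w phi h ->
  (forall r, bq_rels P r -> phi r = 0) ->
  exists G : {rmorphism C -> alg_quot S},
    [/\ scalable G,
        forall v g, G (piC (vert_elt k ((v, g) : vert CQ)))
                    = phi (vert_elt k v) * idem p chi h g
      & forall a g, G (piC (arr_elt k ((a, g) : arr CQ)))
                    = phi (arr_elt k a) * idem p chi h g].
Proof.
move=> phiZ phi_h phi_rels.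
have [F [FZ Fv Fa F_lift]] := covering_path_hom phiZ phi_h.
have [x|G [GZ GE]] := @alg_quot_lift _ _ (bq_rels (covering w)) _ _ F FZ.
  by move=> /= [r Pr [g ->]]; rewrite F_lift phi_rels // mul0r.
by exists G; split=> // [v g|a g]; rewrite GE ?Fv ?Fa.
Qed.

Definition cov_vert (v : vert Q) (g : gT) : C :=
  piC (vert_elt k ((v, g) : vert CQ)).
Definition cov_arr (a : arr Q) (g : gT) : C := piC (arr_elt k ((a, g) : arr CQ)).
Lemma cov_vertM u v g h :
  cov_vert u g * cov_vert v h
  = if (u == v) && (g == h) then cov_vert u g else 0.
Proof.
rewrite -[LHS]rmorphM vert_eltM xpair_eqE.
by case: ifP => _ //; rewrite rmorph0.
Qed.

Lemma cov_arr_org a g : cov_arr a g * cov_vert (org a) g = cov_arr a g.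
Proof.
rewrite -[LHS]rmorphM; congr (piC _).
exact: (arr_elt_org k ((a, g) : arr CQ)).
Qed.

Lemma cov_arr_ter a g : cov_vert (ter a) (g * w a)%g * cov_arr a g = cov_arr a g.
Proof.
rewrite -[LHS]rmorphM; congr (piC _).
exact: (arr_elt_ter k ((a, g) : arr CQ)).
Qed.

Lemma cov_vert_sum : \sum_g \sum_v cov_vert v g = 1.
Proof.
rewrite exchange_big /= (pair_bigA _ cov_vert) /=.
rewrite -(rmorph1 (alg_pi (bq_rels (covering w)))) path_alg1 rmorph_sum.
by apply: eq_bigr => -[].
Qed.

(** The relations of [P] hold in the covering because [phi r] is the sum of the
    [phi r * idem p chi h g], and each of these is the image of a lift of [r]. *)
Lemma covering_crossed :
  exists (phi : {rmorphism path_alg k Q -> C}) (h : C),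
    [/\ scalable phi, crossed p chi w phi h, forall r, bq_rels P r -> phi r = 0,
        forall v g, piC (vert_elt k ((v, g) : vert CQ))
                    = phi (vert_elt k v) * idem p chi h g
      & forall a g, piC (arr_elt k ((a, g) : arr CQ))
                    = phi (arr_elt k a) * idem p chi h g].
Proof.
have [phi [h [phiZ phi_h phi_v phi_a]]] :=
  complete_system_crossed p_prime k_char chi_inj chi_p chiM cov_vertM
    cov_vert_sum cov_arr_org cov_arr_ter.
exists phi, h; split=> // r Pr.
have [F [FZ Fv Fa F_lift]] := covering_path_hom phiZ phi_h.
(* The homomorphism rebuilt from [phi] and [h] is the projection itself, so it kills the lifted
   relations. *)
have FE : F =1 piC.
  apply: path_alg_hom_unique => [//||[v g]|[a g]]; first exact: alg_piZ.
    by rewrite Fv -phi_v.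
  by rewrite Fa -phi_a.
rewrite -[phi r]mulr1 -(idem_sum p_prime k_char chi_inj chi_p gT_card h).
rewrite mulr_sumr big1 // => g _; rewrite -F_lift FE; apply/alg_pi_eq0/ideal_gen_in.
by exists r => //; exists g.
Qed.

Lemma covering_universal :
  exists (phi : {rmorphism path_alg k Q -> C}) (h : C),
    [/\ crossed p chi w phi h, forall r, bq_rels P r -> phi r = 0, scalable phi,
      forall (A : algType k) (S : set A)
          (psi : {rmorphism path_alg k Q -> alg_quot S}) (u : alg_quot S),
        scalable psi -> crossed p chi w psi u ->
        (forall r, bq_rels P r -> psi r = 0) ->
        exists G : {rmorphism C -> alg_quot S},
          [/\ scalable G, G h = u
            & forall a, G (phi (arr_elt k a)) = psi (arr_elt k a)]
    & forall (A : algType k) (S : set A) (f g : {rmorphism C -> alg_quot S}),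
        scalable f -> scalable g -> f h = g h ->
        (forall v, f (phi (vert_elt k v)) = g (phi (vert_elt k v))) ->
        (forall a, f (phi (arr_elt k a)) = g (phi (arr_elt k a))) -> f =1 g].
Proof.
have [phi [h [phiZ phi_h phi_rels phi_v phi_a]]] := covering_crossed.
exists phi, h; split=> // [A S psi u psiZ psi_u psi_rels
  |A S f g fZ gZ fgh fgv fga].
  have [up _ _] := psi_u.
  have [hp _ _] := phi_h.
  have [G [GZ Gv Ga]] := covering_hom psiZ psi_u psi_rels.
  have sum1 (T : algType k) (R : set T) (x : alg_quot R) :
      \sum_g idem p chi x g = 1.
    exact: (idem_sum p_prime k_char chi_inj chi_p gT_card).
  have vert1 (T : algType k) (R : set T)
      (f : {rmorphism path_alg k Q -> alg_quot R}) (x : alg_quot R) :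
      x = \sum_v f (vert_elt k v) * x.
    by rewrite -mulr_suml -rmorph_sum -path_alg1 rmorph1 mul1r.
  exists G; split=> // [|a].
    (* [G] is known only on the vertices and arrows of the covering, so [h] and [u] are expanded
       over their idempotents, and these over the vertices. *)
    rewrite -(idem_expand p_prime k_char chi_inj chi_p gT_card hp).
    rewrite -[RHS](idem_expand p_prime k_char chi_inj chi_p gT_card up).
    rewrite rmorph_sum; apply: eq_bigr => g _; rewrite GZ; congr (_ *: _).
    rewrite [idem p chi h g](vert1 _ _ phi) [RHS](vert1 _ _ psi) rmorph_sum.
    by apply: eq_bigr => v _; rewrite -phi_v Gv.
  rewrite -[phi _]mulr1 -(sum1 _ _ h) mulr_sumr rmorph_sum -[RHS]mulr1.
  rewrite -(sum1 _ _ u) mulr_sumr.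
  by apply: eq_bigr => g _; rewrite -phi_a Ga.
(* The idempotents are polynomials in [h], so agreement at [h] suffices. *)
have fg_idem x : f (idem p chi h x) = g (idem p chi h x).
  by rewrite /idem !quot_horner_map // fgh.
have fg_pi : f \o piC =1 g \o piC.
  apply: path_alg_hom_unique => [a x|a x|[v x]|[a x]] /=.
  - by rewrite alg_piZ fZ.
  - by rewrite alg_piZ gZ.
  - by rewrite phi_v !rmorphM fgv fg_idem.
  - by rewrite phi_a !rmorphM fga fg_idem.
by elim/alg_pi_ind=> x; apply: fg_pi.
Qed.

End CoveringUniversal.

(** * Algebras over the two-loop quiver *)

Section Support.
Variables (k : fieldType) (Q : quiver).
Implicit Types r s : path_alg k Q.

Definition supp_in (T : qpath Q -> Prop) r := forall q, q \in msupp r -> T q.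

Lemma supp_inD (T : qpath Q -> Prop) r s :
  supp_in T r -> supp_in T s -> supp_in T (r + s).
Proof.
move=> Tr Ts q /(fsubsetP (msuppD_le _ _)); rewrite inE => /orP[/Tr|/Ts] //.
Qed.

Lemma supp_inN (T : qpath Q -> Prop) r : supp_in T r -> supp_in T (- r).
Proof. by move=> Tr q; rewrite msuppN => /Tr. Qed.

Lemma supp_in0 (T : qpath Q -> Prop) : supp_in T 0.
Proof. by move=> q; rewrite msupp0. Qed.

Lemma supp_in_elt (T : qpath Q -> Prop) c q : T q -> supp_in T << c *g q >>.
Proof. by move=> Tq t /(fsubsetP msuppU_le); rewrite inE => /eqP->. Qed.

Lemma supp_inM (T U W : qpath Q -> Prop) r s :
  (forall q t u, qpath_comp q t = Some u -> T q -> U t -> W u) ->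
  supp_in T r -> supp_in U s -> supp_in W (r * s).
Proof.
move=> TUW Tr Us; rewrite [r * s]path_mulE big_seq.
apply: (big_ind (supp_in W)) => [|*|q qr]; first exact: supp_in0.
  exact: supp_inD.
rewrite big_seq; apply: (big_ind (supp_in W)) => [|*|t ts]; first exact: supp_in0.
  exact: supp_inD.
case qt: (qpath_comp q t) => [u|] /=; last exact: supp_in0.
by apply: supp_in_elt; apply: TUW qt _ _; [apply: Tr | apply: Us].
Qed.

Lemma supp_lenM m n r s :
  supp_in (fun q => m <= plen q)%N r -> supp_in (fun q => n <= plen q)%N s ->
  supp_in (fun q => m + n <= plen q)%N (r * s).
Proof.
apply: supp_inM => q t u; case: pcompP => // u' _ _ au _ [<-] mq nt.
by rewrite /plen au size_cat addnC leq_add.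
Qed.

Lemma supp_lenX m r n :
  supp_in (fun q => m <= plen q)%N r ->
  supp_in (fun q => n * m <= plen q)%N (r ^+ n).
Proof.
move=> mr; elim: n => [|n IHn]; first by move=> q.
by rewrite exprS mulSn; apply: supp_lenM.
Qed.

Lemma supp_len_arr (a : arr Q) : supp_in (fun q => 1 <= plen q)%N (arr_elt k a).
Proof. exact: supp_in_elt. Qed.

Variables (gT : finGroupType) (w : arr Q -> gT).

(** The weights appear in the opposite order because [r * s] traverses the path of [s] first. *)
Lemma supp_weightM g h r s :
  supp_in (fun q => weight w q = g) r -> supp_in (fun q => weight w q = h) s ->
  supp_in (fun q => weight w q = h * g)%g (r * s).
Proof.
apply: supp_inM => q t u; case: pcompP => // u' _ _ au _ [<-] mq nt.
by rewrite /weight au big_cat /= -/(weight w q) -/(weight w t) mq nt.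
Qed.

Lemma supp_weightX g r n :
  supp_in (fun q => weight w q = g) r ->
  supp_in (fun q => weight w q = g ^+ n)%g (r ^+ n).
Proof.
move=> gr; elim: n => [|n IHn].
  rewrite expr0 path_alg1; apply: (big_ind (supp_in _)) => [|*|v _].
  - exact: supp_in0.
  - exact: supp_inD.
  - by apply: supp_in_elt; rewrite /weight /= big_nil.
by rewrite exprSr expgS; apply: supp_weightM.
Qed.

Lemma supp_weight_arr (a : arr Q) :
  supp_in (fun q => weight w q = w a) (arr_elt k a).
Proof. by apply: supp_in_elt; apply: weight_arr_path. Qed.

Lemma ideal_supp (n : nat) (R : set (path_alg k Q)) r :
  (forall r, R r -> supp_in (fun q => n <= plen q)%N r) ->
  ideal_gen R r -> supp_in (fun q => n <= plen q)%N r.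
Proof.
move=> R_n; elim=> {r} [r /R_n //||r s _ IHr _ IHs|a r _ IHr|a r _ IHr].
- exact: supp_in0.
- exact: supp_inD.
- by rewrite -[n]add0n; apply: supp_lenM.
- by rewrite -[n]addn0; apply: supp_lenM.
Qed.

End Support.

(** * Universal triples, and nilpotency of long paths *)

Section TwoLoops.
Variables (p : nat) (k : fieldType).
Implicit Types alpha beta c : k.

Definition skew_triple alpha beta c (A : algType k) (S : set A)
    (h y z : alg_quot S) : Prop :=
  [/\ h ^+ p = h, h * y = y * h + alpha *: y, h * z = z * h + beta *: z
    & [/\ y ^+ p = 0, y * z - z * y = c *: y ^+ 2 & z ^+ p = 0]].

(** The triple is initial. Targets are restricted to the form [alg_quot S'], which is the form of
    both algebras to be compared. *)
Definition presents alpha beta c (A : algType k) (S : set A)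
    (h y z : alg_quot S) : Prop :=
  [/\ skew_triple alpha beta c h y z,
      forall (A' : algType k) (S' : set A') (h' y' z' : alg_quot S'),
        skew_triple alpha beta c h' y' z' ->
        exists f : {rmorphism alg_quot S -> alg_quot S'},
          [/\ scalable f, f h = h', f y = y' & f z = z']
    & forall (A' : algType k) (S' : set A')
          (f g : {rmorphism alg_quot S -> alg_quot S'}),
        scalable f -> scalable g -> f h = g h -> f y = g y -> f z = g z ->
        f =1 g].

Lemma presents_iso alpha beta c (A A' : algType k) (S : set A) (S' : set A')
    (h y z : alg_quot S) (h' y' z' : alg_quot S') :
  presents alpha beta c h y z -> presents alpha beta c h' y' z' ->
  quot_alg_iso S S'.
Proof.
move=> [t ex un] [t' ex' un'].
have [f [fZ fh fy fz]] := ex _ _ _ _ _ t'.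
have [g [gZ gh gy gz]] := ex' _ _ _ _ _ t.
exists f => //; exists g.
  have gfZ : scalable (g \o f) by move=> a u; rewrite /= fZ gZ.
  apply: (un _ _ (g \o f : {rmorphism _ -> _}) idfun) => //=.
  - by rewrite fh.
  - by rewrite fy.
  - by rewrite fz.
have fgZ : scalable (f \o g) by move=> a u; rewrite /= gZ fZ.
apply: (un' _ _ (f \o g : {rmorphism _ -> _}) idfun) => //=.
- by rewrite gh.
- by rewrite gy.
- by rewrite gz.
Qed.

(** The elements [h], [y], [z] need not be the free generators, since in type C16 [h] is a scalar
    multiple of one. That they generate freely is therefore expressed by the last two hypotheses. *)
Lemma free_presents n (R : set (free_alg k n)) alpha beta c
    (h y z : free_alg k n) :
  (forall (A : algType k) (S : set A)
       (f : {rmorphism free_alg k n -> alg_quot S}), scalable f ->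
     (forall r, R r -> f r = 0) <-> skew_triple alpha beta c (f h) (f y) (f z)) ->
  (forall (A : algType k) (S : set A) (h' y' z' : alg_quot S),
     exists f : {rmorphism free_alg k n -> alg_quot S},
       [/\ scalable f, f h = h', f y = y' & f z = z']) ->
  (forall (A : algType k) (S : set A)
       (f g : {rmorphism free_alg k n -> alg_quot S}),
     scalable f -> scalable g -> f h = g h -> f y = g y -> f z = g z ->
     forall i, f (free_gen k i) = g (free_gen k i)) ->
  presents alpha beta c (alg_pi R h) (alg_pi R y) (alg_pi R z).
Proof.
move=> spec ex un; split=> [|A S h' y' z' t|A S f g fZ gZ fgh fgy fgz].
- apply/(spec _ _ (alg_pi R)) => [|r Rr]; first exact: alg_piZ.
  exact/alg_pi_eq0/ideal_gen_in.
- have [f [fZ fh fy fz]] := ex _ _ h' y' z'.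
  have [|g [gZ gE]] := @alg_quot_lift _ _ R _ _ f fZ.
    by apply/spec => //; rewrite fh fy fz.
  by exists g; rewrite !gE.
have piZ (e : {rmorphism alg_quot R -> alg_quot S}) :
    scalable e -> scalable (e \o alg_pi R).
  by move=> eZ a x; rewrite /= alg_piZ eZ.
have fg : f \o alg_pi R =1 g \o alg_pi R.
  by apply: free_alg_hom_unique;
    [exact: piZ | exact: piZ | apply: un=> //; exact: piZ].
by elim/alg_pi_ind=> x; apply: fg.
Qed.

Lemma two_loops_vert v : vert_elt k (v : vert two_loops) = 1.
Proof.
by case: v; rewrite path_alg1 (bigD1 tt) //= big1 ?addr0 // => -[].
Qed.

Lemma two_loops_arr (T : arr two_loops -> Prop) :
  T loop_y -> T loop_z -> forall a, T a.
Proof.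
move=> Ty Tz [[|[|//]] lt_a].
  by have <- : loop_y = Ordinal lt_a by apply: val_inj.
by have <- : loop_z = Ordinal lt_a by apply: val_inj.
Qed.

Lemma two_loops_hom (A : algType k) (S : set A) (y z : alg_quot S) :
  exists f : {rmorphism path_alg k two_loops -> alg_quot S},
    [/\ scalable f, f (arr_elt k loop_y) = y & f (arr_elt k loop_z) = z].
Proof.
pose e (v : vert two_loops) := 1 : alg_quot S.
pose f (a : arr two_loops) := if a == loop_y then y else z.
have eM u v : e u * e v = if u == v then e u else 0.
  by case: u v => [] []; rewrite eqxx mulr1.
have e_sum : \sum_v e v = 1.
  by rewrite (bigD1 tt) //= big1 ?addr0 // => -[].
have [a|a|F [FZ _ Fa]] := @path_alg_hom _ two_loops _ _ e f eM e_sum.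
- exact: mulr1.
- exact: mul1r.
by exists F; split=> //; apply: Fa.
Qed.

(* The relations [R] define [k<y,z>/(y^p, yz - zy - c y^2, z^p)]. *)
Definition loop_rels_spec c (R : set (path_alg k two_loops)) : Prop :=
  forall (A : algType k) (S : set A)
      (f : {rmorphism path_alg k two_loops -> alg_quot S}), scalable f ->
    let y := f (arr_elt k loop_y) in let z := f (arr_elt k loop_z) in
    (forall r, R r -> f r = 0) <->
    [/\ y ^+ p = 0, y * z - z * y = c *: y ^+ 2 & z ^+ p = 0].

Lemma covering_presents (gT : finGroupType) (chi : gT -> k) c
    (R : set (path_alg k two_loops)) (w : arr two_loops -> gT) :
  prime p -> p \in [pchar k] -> injective chi -> (forall g, chi g ^+ p = chi g) ->
  (forall g h, chi (g * h)%g = chi g + chi h) -> #|gT| = p ->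
  loop_rels_spec c R ->
  exists h y z : alg_quot (bq_rels (@covering k (BoundQuiver R) gT w)),
    presents (chi (w loop_y)) (chi (w loop_z)) c h y z.
Proof.
move=> p_prime k_char chi_inj chi_p chiM gT_card spec.
have [phi [h [[hp _ ha] phi_rels phiZ ex un]]] :=
  covering_universal p_prime k_char chi_inj chi_p chiM gT_card
    (P := BoundQuiver R) w.
exists h, (phi (arr_elt k loop_y)), (phi (arr_elt k loop_z)).
split=> [|A S h' y' z' [h'p h'y h'z yz]|A S f g fZ gZ fgh fgy fgz].
- by split=> //; apply/(spec _ _ phi).
- have [psi [psiZ psi_y psi_z]] := two_loops_hom y' z'.
  have [||G [GZ Gh Ga]] := ex _ _ psi h' psiZ.
  + split=> // [v|]; first by rewrite two_loops_vert rmorph1 mulr1 mul1r.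
    apply: (@two_loops_arr (fun a => h' * psi (arr_elt k a)
      = psi (arr_elt k a) * h' + chi (w a) *: psi (arr_elt k a))).
      by rewrite psi_y.
    by rewrite psi_z.
  + suff yz' Y Z : Y = y' -> Z = z' ->
        [/\ Y ^+ p = 0, Y * Z - Z * Y = c *: Y ^+ 2 & Z ^+ p = 0].
      exact: (spec _ _ psi psiZ).2 (yz' _ _ psi_y psi_z).
    by move=> -> ->.
  exists G; split=> //; first exact: etrans (Ga _) psi_y.
  exact: etrans (Ga _) psi_z.
apply: (un _ _ f g fZ gZ fgh) => [v|].
  by rewrite two_loops_vert !rmorph1.
exact: (@two_loops_arr
  (fun a => f (phi (arr_elt k a)) = g (phi (arr_elt k a))) fgy fgz).
Qed.

(** The commutator with [z] is a derivation sending y to -c y^2, hence y^i to -i c y^(i+1). *)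
Lemma skew_commX c (A : algType k) (S : set A) (y z : alg_quot S) i :
  y * z - z * y = c *: y ^+ 2 ->
  z * y ^+ i = y ^+ i * z - (c *+ i) *: y ^+ i.+1.
Proof.
move=> yz; have zy : z * y = y * z - c *: y ^+ 2 by rewrite -yz subKr.
elim: i => [|i IHi]; first by rewrite mulr1 mul1r scale0r subr0.
have -> : z * y ^+ i.+1 = z * y ^+ i * y by rewrite exprSr mulrA.
rewrite IHi mulrBl -(mulrA _ z) zy mulrBr mulrA -exprSr quot_scaleAr quot_scaleAl.
by rewrite -exprD addn2 -exprSr -addrA -opprD -scalerDl -mulrS.
Qed.

(* Multiplying a path on the right by [y ^+ i * z ^+ j] lets its first arrow be
   absorbed, the [z]'s being moved to the right past the [y]'s. *)
Lemma loop_nilpotent c (A : algType k) (S : set A)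
    (f : {rmorphism path_alg k two_loops -> alg_quot S}) (y z : alg_quot S) :
  f (arr_elt k loop_y) = y -> f (arr_elt k loop_z) = z ->
  y ^+ p = 0 -> y * z - z * y = c *: y ^+ 2 -> z ^+ p = 0 ->
  forall q, (p + p <= plen q)%N -> f (path_elt k q) = 0.
Proof.
move=> fy fz yp yz zp q le_q.
suff mono i j : (p + p <= plen q + (i + j))%N ->
    f (path_elt k q) * (y ^+ i * z ^+ j) = 0.
  by have := mono 0 0; rewrite addn0 !mulr1; apply.
elim/qpath_ind: q {le_q} i j => [v|a q s qa IHq] i j le_ij.
  (* For a trivial path the exponents alone sum to at least 2p, so one of them reaches [p]; this is
     where the bound [p + p] comes from. *)
  have [pi|pj] : (p <= i)%N \/ (p <= j)%N.
  - case: (leqP p i) => [|ip]; [by left | right; rewrite leqNgt; apply/negP => jp].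
    have := leq_add ip (ltnW jp); rewrite addSn ltnNge => /negP; apply.
    exact: le_ij.
  - by rewrite -(subnK pi) exprD yp mulr0 mul0r mulr0.
  - by rewrite -(subnK pj) [z ^+ _]exprD zp !mulr0.
have le_q : (p + p <= plen q + (i + j).+1)%N.
  move: le_ij; rewrite addnS -addSn /plen.
  case: pcompP qa => // s' _ _ as_ _ [<-].
  by rewrite as_ size_cat.
have -> : path_elt k s = path_elt k q * arr_elt k a by rewrite [RHS]path_eltM qa.
rewrite rmorphM -mulrA.
suff [qy qz] : f (path_elt k q) * (y * (y ^+ i * z ^+ j)) = 0
    /\ f (path_elt k q) * (z * (y ^+ i * z ^+ j)) = 0.
  apply: (@two_loops_arr (fun a =>
    f (path_elt k q) * (f (arr_elt k a) * (y ^+ i * z ^+ j)) = 0)).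
    exact: (etrans (congr1 (fun u => f (path_elt k q) * (u * _)) fy) qy).
  exact: (etrans (congr1 (fun u => f (path_elt k q) * (u * _)) fz) qz).
split; first by rewrite mulrA -exprS IHq // addSn.
(* Both resulting terms, in y^i z^(j+1) and y^(i+1) z^j, have total degree i + j + 1, so the
   induction hypothesis kills each of them. *)
rewrite mulrA (skew_commX _ yz) mulrBl quot_scaleAl -mulrA -exprS mulrBr.
by rewrite quot_scaleAr !IHq ?scaler0 ?subr0 // ?addSn // addnS.
Qed.

Lemma loop_admissible c (R : set (path_alg k two_loops)) :
  loop_rels_spec c R ->
  (forall r, R r -> supp_in (fun q => 2 <= plen q)%N r) ->
  admissible (BoundQuiver R).
Proof.
move=> spec R2; split; last by move=> r; apply: ideal_supp.
exists (p + p)%N => q le_q; apply/alg_pi_eq0.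
have [|yp yz zp] := (spec _ _ (alg_pi R) (@alg_piZ _ _ R)).1.
  by move=> r Rr; apply/alg_pi_eq0/ideal_gen_in.
exact: (loop_nilpotent erefl erefl yp yz zp le_q).
Qed.

End TwoLoops.

(** * The presentations B1, B3 and C16 *)

Section CyclicCharacter.
Variables (p : nat) (k : fieldType) (gT : finGroupType) (sigma : gT).
Hypotheses (k_char : p \in [pchar k]).
Hypotheses (G_cyclic : [set: gT]%g = <[sigma]>%g) (G_order : #|[set: gT]%g| = p).

Lemma natr_eq_pchar m n : (m%:R == n%:R :> k) = (m == n %[mod p])%N.
Proof.
wlog le_mn : m n / (m <= n)%N.
  move=> H; case: (leqP m n) => [/H //|/ltnW/H E].
  by rewrite eq_sym E eq_sym.
by rewrite eq_sym -subr_eq0 -natrB // -(dvdn_pcharf k_char) eq_sym eqn_mod_dvd.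
Qed.

(** [chi] is the logarithm to base [sigma] read in [k]. The chosen exponent matters only modulo the
    order of [sigma], which is the characteristic; this gives both additivity and injectivity. *)
Lemma cyclic_character :
  exists chi : gT -> k,
    [/\ injective chi, forall g, chi g ^+ p = chi g,
        forall g h, chi (g * h)%g = chi g + chi h & chi sigma = 1].
Proof.
have ex g : exists n, (sigma ^+ n)%g = g.
  have /cycleP[n ->] : g \in <[sigma]>%g by rewrite -G_cyclic inE.
  by exists n.
have [ell ellE] := boolp.choice ex.
have chiX n : (ell (sigma ^+ n)%g)%:R = n%:R :> k.
  apply/eqP; rewrite natr_eq_pchar -G_order G_cyclic -[#|_|]/(#[sigma]%g).
  by rewrite -eq_expg_mod_order ellE.
exists (fun g => (ell g)%:R); split=> [g h /eqP|g|g h|].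
- rewrite natr_eq_pchar -G_order G_cyclic -[#|_|]/(#[sigma]%g).
  by rewrite -eq_expg_mod_order !ellE => /eqP.
- by rewrite -(pFrobenius_autE k_char) pFrobenius_aut_nat.
- by rewrite -{1}[g]ellE -{1}[h]ellE -expgD chiX natrD.
- by rewrite -[in LHS](expg1 sigma) chiX.
Qed.

End CyclicCharacter.

Lemma character_expgz (k : fieldType) (gT : finGroupType) (chi : gT -> k) g a :
  (forall g h, chi (g * h)%g = chi g + chi h) ->
  chi (expgz g a) = a%:~R * chi g.
Proof.
move=> chiM; have chi1 : chi 1%g = 0.
  by apply: (addrI (chi 1%g)); rewrite -chiM mulg1 addr0.
have chiX n : chi (g ^+ n)%g = n%:R * chi g.
  elim: n => [|n IHn]; first by rewrite mul0r.
  by rewrite expgS chiM IHn -{1}[chi g]mul1r -mulrDl nat1r.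
case: a => n; first exact: chiX.
rewrite NegzE mulrNz mulNr -chiX; apply/eqP.
by rewrite -addr_eq0 -chiM mulVg chi1.
Qed.

Section Presentations.
Variables (p : nat) (k : fieldType).
Hypothesis p_prime : prime p.
Implicit Types (A : algType k) (lambda : k).

Lemma forall_set3 T (P : T -> Prop) a b c :
  (forall r, [set a; b; c]%classic r -> P r) <-> [/\ P a, P b & P c].
Proof.
split=> [H|[Pa Pb Pc] r [[->|->]|->] //].
by split; apply: H; [left; left|left; right|right].
Qed.

Lemma forall_set6 T (P : T -> Prop) a b c d e g :
  (forall r, [set a; b; c; d; e; g]%classic r -> P r) <->
  [/\ P a, P b, P c & [/\ P d, P e & P g]].
Proof.
split=> [H|[Pa Pb Pc [Pd Pe Pg]] r [[[[[->|->]|->]|->]|->]|->] //].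
by split; [| | |split]; apply: H;
  [do 5 left|do 4 left; right|do 3 left; right|left; left; right|left; right|right].
Qed.

Lemma subr0_iff (V : zmodType) (u v : V) : u - v = 0 <-> u = v.
Proof. by split=> [/eqP|->]; rewrite ?subrr // subr_eq0 => /eqP. Qed.

Lemma rmorph_commutator (A B : pzRingType) (f : {rmorphism A -> B}) a b :
  f (a * b - b * a) = f a * f b - f b * f a.
Proof. by rewrite rmorphB !rmorphM. Qed.

Lemma Lambda1_spec : loop_rels_spec p 0 (bq_rels (Lambda1 k p)).
Proof.
move=> A S f fZ y z; apply: (iff_trans (forall_set3 _ _ _ _)).
have fy : f (arr_elt k loop_y ^+ p) = y ^+ p := rmorphXn f p _.
have fz : f (arr_elt k loop_z ^+ p) = z ^+ p := rmorphXn f p _.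
have fyz := rmorph_commutator f (arr_elt k loop_y) (arr_elt k loop_z).
rewrite scale0r; split=> -[h1 h2 h3]; split.
- exact: etrans (esym fy) h1.
- exact: etrans (esym fyz) h2.
- exact: etrans (esym fz) h3.
- exact: etrans fy h1.
- exact: etrans fyz h2.
- exact: etrans fz h3.
Qed.

Lemma Lambda2_spec : loop_rels_spec p 1 (bq_rels (Lambda2 k p)).
Proof.
move=> A S f fZ y z; apply: (iff_trans (forall_set3 _ _ _ _)).
have fy : f (arr_elt k loop_y ^+ p) = y ^+ p := rmorphXn f p _.
have fz : f (arr_elt k loop_z ^+ p) = z ^+ p := rmorphXn f p _.
have fyz := etrans (rmorphB f _ _) (congr2 (fun u v => u - v)
  (rmorph_commutator f (arr_elt k loop_y) (arr_elt k loop_z))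
  (rmorphXn f 2 (arr_elt k loop_y))).
have yz := subr0_iff (y * z - z * y) (y ^+ 2).
rewrite scale1r; split=> -[h1 h2 h3]; split.
- exact: etrans (esym fy) h1.
- exact: (yz.1 (etrans (esym fyz) h2)).
- exact: etrans (esym fz) h3.
- exact: etrans fy h1.
- exact: etrans fyz (yz.2 h2).
- exact: etrans fz h3.
Qed.

Lemma ord3_ind (T : 'I_3 -> Prop) :
  T (@Ordinal 3 0 isT) -> T (@Ordinal 3 1 isT) -> T (@Ordinal 3 2 isT) ->
  forall i, T i.
Proof.
move=> T0 T1 T2 [[|[|[|//]]] lt_i].
- by have <- : @Ordinal 3 0 isT = Ordinal lt_i by apply: val_inj.
- by have <- : @Ordinal 3 1 isT = Ordinal lt_i by apply: val_inj.
- by have <- : @Ordinal 3 2 isT = Ordinal lt_i by apply: val_inj.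
Qed.

Lemma free_alg3_hom A (S : set A) (u v t : alg_quot S) :
  exists f : {rmorphism free_alg k 3 -> alg_quot S},
    [/\ scalable f, f (gen_x k) = u, f (gen_y k) = v & f (gen_z k) = t].
Proof.
have [f [fZ fE]] := free_alg_hom (fun i : 'I_3 => nth 0 [:: u; v; t] i).
by exists f; split=> //; apply: fE.
Qed.

Lemma free_alg3_ext A (S : set A) (f g : {rmorphism free_alg k 3 -> alg_quot S}) :
  f (gen_x k) = g (gen_x k) -> f (gen_y k) = g (gen_y k) ->
  f (gen_z k) = g (gen_z k) -> forall i, f (free_gen k i) = g (free_gen k i).
Proof.
move=> fgx fgy fgz.
exact: (@ord3_ind (fun i => f (free_gen k i) = g (free_gen k i))).
Qed.

Lemma bracketE A (S : set A) (f : {rmorphism free_alg k 3 -> alg_quot S}) u v :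
  f (bracket u v) = f u * f v - f v * f u.
Proof. exact: rmorph_commutator. Qed.

Lemma skew_triple_iff alpha beta c A (S : set A) (h y z : alg_quot S) :
  [/\ h * y - y * h - alpha *: y = 0, h * z - z * h - beta *: z = 0,
      y * z - z * y - c *: y ^+ 2 = 0
    & [/\ h ^+ p - h = 0, y ^+ p = 0 & z ^+ p = 0]] <->
  skew_triple p alpha beta c h y z.
Proof.
have shift (u v t : alg_quot S) : u - v - t = 0 <-> u = v + t.
  by rewrite -addrA -opprD; apply: subr0_iff.
split=> [[hy hz yz [hp yp zp]]|[hp hy hz [yp yz zp]]].
  by split; [exact/subr0_iff | exact/shift | exact/shift | split=> //; exact/subr0_iff].
by split; [exact/shift | exact/shift | exact/subr0_iff | split=> //; exact/subr0_iff].
Qed.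

Lemma vanish6_congr (V : zmodType) (a1 a2 a3 a4 a5 a6 b1 b2 b3 b4 b5 b6 : V) :
  a1 = b1 -> a2 = b2 -> a3 = b3 -> a4 = b4 -> a5 = b5 -> a6 = b6 ->
  [/\ a1 = 0, a2 = 0, a3 = 0 & [/\ a4 = 0, a5 = 0 & a6 = 0]] <->
  [/\ b1 = 0, b2 = 0, b3 = 0 & [/\ b4 = 0, b5 = 0 & b6 = 0]].
Proof. by do 6 move=> ->. Qed.

Lemma B1_presents : presents p 1 0 0 (alg_pi (B1_rels k p) (gen_x k))
  (alg_pi (B1_rels k p) (gen_y k)) (alg_pi (B1_rels k p) (gen_z k)).
Proof.
apply: free_presents => [A S f fZ|A S|A S f g _ _].
- apply: (iff_trans (forall_set6 _ _ _ _ _ _ _)).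
  apply: (iff_trans _ (skew_triple_iff _ _ _ _ _ _)).
  apply: vanish6_congr.
  + by rewrite rmorphB bracketE scale1r.
  + by rewrite bracketE scale0r subr0.
  + by rewrite bracketE scale0r subr0.
  + by rewrite rmorphB rmorphXn.
  + exact: rmorphXn.
  + exact: rmorphXn.
- exact: free_alg3_hom.
- exact: free_alg3_ext.
Qed.

Lemma B3_presents : presents p 1 1 1 (alg_pi (B3_rels k p) (gen_x k))
  (alg_pi (B3_rels k p) (gen_y k)) (alg_pi (B3_rels k p) (gen_z k)).
Proof.
apply: free_presents => [A S f fZ|A S|A S f g _ _].
- apply: (iff_trans (forall_set6 _ _ _ _ _ _ _)).
  apply: (iff_trans _ (skew_triple_iff _ _ _ _ _ _)).
  apply: vanish6_congr.
  + by rewrite rmorphB bracketE scale1r.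
  + by rewrite rmorphB bracketE scale1r.
  + by rewrite rmorphB bracketE scale1r rmorphXn.
  + by rewrite rmorphB rmorphXn.
  + exact: rmorphXn.
  + exact: rmorphXn.
- exact: free_alg3_hom.
- exact: free_alg3_ext.
Qed.

Lemma vanish_scale (V : lmodType k) (b : k) (u v : V) :
  b != 0 -> v = b *: u -> u = 0 <-> v = 0.
Proof.
move=> b0 ->; split=> [->|/eqP]; first exact: scaler0.
by rewrite scaler_eq0 (negbTE b0) => /eqP.
Qed.

(** The nilpotent generators [x] and [y] take the places of the two loops. Dividing [z] by [lambda]
    turns z^p = lambda^(p-1) z into h^p = h and the eigenvalue shift of [x] into -1; that of [y]
    becomes -lambda^-2 = -a. *)
Lemma C16_presents lambda (a : k) : lambda != 0 -> lambda^-1 = a * lambda ->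
  let R := C16_rels k p lambda (lambda ^+ p.-1) in
  presents p (- 1) (- a) 0 (alg_pi R (lambda^-1 *: gen_z k))
    (alg_pi R (gen_x k)) (alg_pi R (gen_y k)).
Proof.
move=> l0 la R; have li0 : - lambda^-1 != 0 by rewrite oppr_eq0 invr_eq0.
have aE : a = lambda^-1 * lambda^-1 by rewrite {1}la mulfK.
apply: free_presents => [A S f fZ|A S h y z|A S f g fZ gZ].
- apply: (iff_trans (forall_set6 _ _ _ _ _ _ _)).
  apply: (iff_trans _ (skew_triple_iff _ _ _ _ _ _)).
  pose X := f (gen_x k); pose Y := f (gen_y k); pose Z := f (gen_z k).
  have -> : f (lambda^-1 *: gen_z k) = lambda^-1 *: Z := fZ _ _.
  rewrite -/X -/Y.
  have fxy : f (bracket (gen_x k) (gen_y k)) = X * Y - Y * X - 0 *: X ^+ 2.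
    by rewrite bracketE scale0r subr0.
  have fz (u : free_alg k 3) mu : f (bracket u (gen_z k) - mu *: u)
      = f u * Z - Z * f u - mu *: f u.
    by rewrite rmorphB bracketE fZ.
  have shift (U : alg_quot S) mu : U * Z - Z * U - mu *: U = 0 <->
      (lambda^-1 *: Z) * U - U * (lambda^-1 *: Z) - (- (lambda^-1 * mu)) *: U = 0.
    apply: (vanish_scale li0).
    rewrite quot_scaleAl quot_scaleAr scalerBr scalerBr scaleNr scaleNr opprK.
    by rewrite scaleNr opprK scaleNr opprK scalerA [- _ + _]addrC.
  (* The two equations differ by the nonzero factor lambda^-p. *)
  have fzp : f (gen_z k ^+ p - lambda ^+ p.-1 *: gen_z k) = 0
      <-> (lambda^-1 *: Z) ^+ p - lambda^-1 *: Z = 0.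
    have lpE : lambda^-1 = lambda^-1 ^+ p * lambda ^+ p.-1.
      rewrite -{1}(prednK (prime_gt0 p_prime)) exprS -mulrA -exprMn.
      by rewrite mulVf // expr1n mulr1.
    have lp0 : lambda^-1 ^+ p != 0 by rewrite expf_neq0 // invr_eq0.
    apply: (vanish_scale lp0); rewrite rmorphB fZ rmorphXn scalerBr scalerA.
    by rewrite quot_exprZ -lpE.
  have s1 := shift X lambda; rewrite mulVf // in s1.
  have s2 := shift Y lambda^-1; rewrite -aE in s2.
  have fx := rmorphXn f p (gen_x k); have fy := rmorphXn f p (gen_y k).
  split=> [[h1 h2 h3 [h4 h5 h6]]|[h1 h2 h3 [h4 h5 h6]]].
    split; [exact: (s1.1 (etrans (esym (fz _ _)) h2))
      | exact: (s2.1 (etrans (esym (fz _ _)) h3)) | exact: etrans (esym fxy) h1 |].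
    by split; [exact: fzp.1 | exact: etrans (esym fx) h4 | exact: etrans (esym fy) h5].
  split; [exact: etrans fxy h3 | exact: etrans (fz _ _) (s1.2 h1)
    | exact: etrans (fz _ _) (s2.2 h2) |].
  by split; [exact: etrans fx h5 | exact: etrans fy h6 | exact: fzp.2].
- have [f [fZ fx fy fz]] := free_alg3_hom y z (lambda *: h).
  by exists f; split; rewrite // fZ fz scalerA mulVf // scale1r.
move=> fgz fgx fgy; apply: free_alg3_ext => //.
apply: (scalerI (a := lambda^-1)); first by rewrite invr_eq0.
exact: etrans (esym (fZ _ _)) (etrans fgz (gZ _ _)).
Qed.

(** * Homogeneity of the relations of the local algebras *)

Lemma supp_lenW (Q : quiver) m n (r : path_alg k Q) : (m <= n)%N ->
  supp_in (fun q => n <= plen q)%N r -> supp_in (fun q => m <= plen q)%N r.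
Proof. by move=> le_mn rn q /rn; apply: leq_trans. Qed.

Let supp_len_arrX (a : arr two_loops) n : (1 < n)%N ->
  supp_in (fun q => 2 <= plen q)%N (arr_elt k a ^+ n).
Proof.
move=> n1; apply: (@supp_lenW _ _ (n * 1)%N); first by rewrite muln1.
by apply: supp_lenX; apply: supp_len_arr.
Qed.

Let supp_len_arrM (a b : arr two_loops) :
  supp_in (fun q => 2 <= plen q)%N (arr_elt k a * arr_elt k b).
Proof. by apply: (@supp_lenM _ _ 1 1); apply: supp_len_arr. Qed.

Lemma two_loops_coverable (gT : finGroupType) c (R : set (path_alg k two_loops))
    (w : arr two_loops -> gT) :
  loop_rels_spec p c R -> (forall r, R r -> supp_in (fun q => 2 <= plen q)%N r) ->
  (forall r, R r -> weight_homogeneous w r) ->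
  @coverable k (BoundQuiver R) gT w.
Proof.
move=> spec R2 Rw; split; first exact: (loop_admissible spec).
move=> r Rr; split; last exact: Rw.
by exists tt, tt => q _; case: (porg q) (pter q) => [] [].
Qed.

(** The terms y z and z y have as weights the two products of the loop weights, which agree when
    these commute. *)
Lemma Lambda1_coverable (gT : finGroupType) (w : arr two_loops -> gT) :
  commute (w loop_y) (w loop_z) -> @coverable k (Lambda1 k p) gT w.
Proof.
move=> wC; have p1 := prime_gt1 p_prime.
apply: (two_loops_coverable Lambda1_spec).
  apply/forall_set3; split; [exact: supp_len_arrX | | exact: supp_len_arrX].
  by apply: supp_inD; last apply: supp_inN; apply: supp_len_arrM.
apply/forall_set3; split.
- by exists (w loop_y ^+ p)%g; apply: supp_weightX; apply: supp_weight_arr.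
- exists (w loop_z * w loop_y)%g; apply: supp_inD.
    by apply: supp_weightM; apply: supp_weight_arr.
  by rewrite -wC; apply: supp_inN; apply: supp_weightM; apply: supp_weight_arr.
- by exists (w loop_z ^+ p)%g; apply: supp_weightX; apply: supp_weight_arr.
Qed.

(** The terms y z and y^2 have the same weight only if the two loops do. *)
Lemma Lambda2_coverable (gT : finGroupType) (w : arr two_loops -> gT) :
  w loop_y = w loop_z -> @coverable k (Lambda2 k p) gT w.
Proof.
move=> wyz; have p1 := prime_gt1 p_prime.
apply: (two_loops_coverable Lambda2_spec).
  apply/forall_set3; split; [exact: supp_len_arrX | | exact: supp_len_arrX].
  apply: supp_inD; last by apply: supp_inN; apply: supp_len_arrX.
  by apply: supp_inD; last apply: supp_inN; apply: supp_len_arrM.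
apply/forall_set3; split.
- by exists (w loop_y ^+ p)%g; apply: supp_weightX; apply: supp_weight_arr.
- exists (w loop_y * w loop_y)%g; apply: supp_inD.
    apply: supp_inD.
      by rewrite {1}wyz; apply: supp_weightM; apply: supp_weight_arr.
    apply: supp_inN.
    by rewrite {2}wyz; apply: supp_weightM; apply: supp_weight_arr.
  apply: supp_inN; rewrite -[X in arr_elt k loop_y ^+ X]/(1 + 1)%N.
  by apply: supp_weightM; apply: supp_weight_arr.
- by exists (w loop_z ^+ p)%g; apply: supp_weightX; apply: supp_weight_arr.
Qed.

End Presentations.

(** Otherwise all the [delta_poly (chi g)] would vanish at [c], although their sum is 1. *)
Lemma prime_field_character (p : nat) (k : fieldType) (gT : finGroupType)
    (chi : gT -> k) (c : k) :
  prime p -> p \in [pchar k] -> injective chi -> (forall g, chi g ^+ p = chi g) ->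
  #|gT| = p -> c ^+ p = c -> exists g, c = chi g.
Proof.
move=> p_prime k_char chi_inj chi_p gT_card cp.
have [/existsP[g /eqP]|/existsPn chi_c] := boolP [exists g, c == chi g].
  by exists g.
have := congr1 (fun q => q.[c])
  (delta_poly_sum p_prime k_char chi_inj chi_p gT_card).
rewrite horner_sum hornerC big1 => [/esym/eqP|g _]; first by rewrite oner_eq0.
by rewrite horner_delta_poly // eq_sym (negbTE (chi_c g)).
Qed.

Lemma covering_iso (p : nat) (k : fieldType) (gT : finGroupType) (chi : gT -> k)
    (alpha beta c : k) (R : set (path_alg k two_loops)) (w : arr two_loops -> gT)
    (A : algType k) (T : set A) (h y z : alg_quot T) :
  prime p -> p \in [pchar k] -> injective chi -> (forall g, chi g ^+ p = chi g) ->
  (forall g g', chi (g * g')%g = chi g + chi g') -> #|gT| = p ->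
  chi (w loop_y) = alpha -> chi (w loop_z) = beta ->
  loop_rels_spec p c R -> presents p alpha beta c h y z ->
  @coverable k (BoundQuiver R) gT w -> @iso_covering k A T (BoundQuiver R) gT w.
Proof.
move=> p_prime k_char chi_inj chi_p chiM gT_card <- <- spec T_pres w_cov.
split=> //; have [h' [y' [z' C_pres]]] :=
  covering_presents w p_prime k_char chi_inj chi_p chiM gT_card spec.
exact: presents_iso T_pres C_pres.
Qed.

Theorem proposition7p2 (p : nat) (k : fieldType) (gT : finGroupType) (sigma : gT)
    (p_prime : prime p) (k_char : p \in [pchar k])
    (G_cyclic : [set: gT]%g = <[sigma]>%g) (G_order : #|[set: gT]%g| = p) :
  (* (a) *)
  [/\ quot_alg_iso (B1_rels k p) (C11_rels k p),
      iso_covering (B1_rels k p) (Lambda1 k p) (loop_weight sigma 1%g)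
    & iso_covering (C11_rels k p) (Lambda1 k p) (loop_weight sigma 1%g)]
  /\
  (* (b) *)
  ((2 < p)%N ->
     iso_covering (B3_rels k p) (Lambda2 k p) (loop_weight sigma sigma))
  /\
  (* (c) *)
  (((2 < p)%N ->
      exists2 F : finFieldType, #|F| = (p ^ 2)%N & inhabited {rmorphism F -> k}) ->
   forall lambda delta : k,
     lambda != 0 -> delta = lambda ^+ p.-1 -> delta = 1 \/ delta = - 1 ->
     (exists a : int, lambda^-1 = a%:~R * lambda) /\
     (forall a : int, lambda^-1 = a%:~R * lambda ->
        iso_covering (C16_rels k p lambda delta) (Lambda1 k p)
          (loop_weight (sigma^-1)%g (expgz sigma (- a))))).
Proof.
have [chi [chi_inj chi_p chiM chi_s]] := cyclic_character k_char G_cyclic G_order.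
have gT_card : #|gT| = p by rewrite -cardsT.
have chiZ a : chi (expgz sigma a) = a%:~R by rewrite character_expgz // chi_s mulr1.
have B1_iso : iso_covering (B1_rels k p) (Lambda1 k p) (loop_weight sigma 1%g).
  apply: (covering_iso p_prime k_char chi_inj chi_p chiM gT_card _ _
    (@Lambda1_spec p k) (B1_presents p k)) => //; first exact: (chiZ 0).
  apply: Lambda1_coverable => //; exact: etrans (mulg1 _) (esym (mul1g _)).
split; last split.
(* B1 and C11 have literally the same relations, so the identity is an isomorphism. *)
- split=> //; exists idfun => //; by exists idfun.
- move=> _; apply: (covering_iso p_prime k_char chi_inj chi_p chiM gT_card _ _
    (@Lambda2_spec p k) (B3_presents p k)) => //.
  exact: Lambda2_coverable.
move=> _ lambda delta l0 -> delta_pm1; split=> [|a la].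
  (* As delta^-2 = 1, lambda^-2 is fixed by Frobenius; it is thus a value of [chi], and its
     logarithm to base [sigma] serves as [a]. *)
  have cp : (lambda^-1 * lambda^-1) ^+ p = lambda^-1 * lambda^-1.
    rewrite -(prednK (prime_gt0 p_prime)) exprS exprMn exprVn.
    by case: delta_pm1 => ->; rewrite ?invrN !invr1 ?mulrNN !mulr1.
  have [g cg] := prime_field_character p_prime k_char chi_inj chi_p gT_card cp.
  have /cycleP[n gE] : g \in <[sigma]>%g by rewrite -G_cyclic inE.
  by exists n%:Z; rewrite -[_%:~R]chiZ /= -gE -cg -mulrA mulVf // mulr1.
apply: (covering_iso p_prime k_char chi_inj chi_p chiM gT_card _ _
  (@Lambda1_spec p k) (C16_presents p_prime l0 la)).
(* [Negz 0] is -1, and the corresponding power of [sigma] reduces to its inverse. *)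
- exact: (chiZ (Negz 0)).
- by rewrite [LHS]chiZ rmorphN.
- apply: Lambda1_coverable => //=.
  apply: (centsP (A := [set: gT]%g) (B := [set: gT]%g)).
  + by rewrite -abelianE G_cyclic cycle_abelian.
  + by rewrite inE.
  + by rewrite inE.
Qed.
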